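(* Let $F$ range over infinitely generated free groups and let $\varkappa$ denote the (infinite) rank of $F$. Then the second-order theory of the set $\varkappa$ and the elementary (first-order) theory of the group $\operatorname{Aut}(F)$ are mutually syntactically interpretable, uniformly in $F$. That is: (1) for every second-order sentence $\chi$ of the empty language there is a first-order sentence $\chi^*$ of the language of groups such that for every infinite cardinal $\varkappa$ and every free group $F$ of rank $\varkappa$, $$\chi \in \operatorname{Th}(\varkappa,\mathbf{L}_2) \iff \chi^* \in \operatorname{Th}(\operatorname{Aut}(F));$$ (2) for every first-order sentence $\theta$ of the language of groups there is a second-order sentence $\theta^{\circ}$ of the empty language such that for every infinite cardinal $\varkappa$ and every free group $F$ of rank $\varkappa$, $$\theta \in \operatorname{Th}(\operatorname{Aut}(F)) \iff \theta^{\circ} \in \operatorname{Th}(\varkappa,\mathbf{L}_2).$$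
   Context: $\operatorname{Th}(\varkappa,\mathbf{L}_2)$ is the (full) second-order theory of the cardinal $\varkappa$ regarded as a set with no structure: the set of second-order sentences of the empty language (with quantifiers over elements and over relations of arbitrary finite arity, full semantics) that are true in $\varkappa$. $\operatorname{Th}(\operatorname{Aut}(F))$ is the complete first-order theory of the group $\operatorname{Aut}(F)$ of all automorphisms of $F$. *)

(* Defs.v *)
From HB Require Import structures.
From mathcomp Require Import all_boot.
From mathcomp Require Import boolp classical_sets functions cardinality.

Set Implicit Arguments.
Unset Strict Implicit.
Unset Printing Implicit Defensive.

Local Open Scope classical_set_scope.
Local Open Scope group_scope.

(* Second-order logic over the empty language (with equality).  A relation    *)
(* variable is a pair (arity, name).  The connectives and quantifiers not     *)
(* listed are the usual classical abbreviations.                              *)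

Definition relvar : Type := (nat * nat)%type.

Inductive so_formula : Type :=
| SOEq of nat & nat
| SORel (X : relvar) of (X.1).-tuple nat
| SOFalse
| SOImp of so_formula & so_formula
| SOAll of nat & so_formula
| SOAllRel of relvar & so_formula.

Arguments SORel : clear implicits.

Fixpoint so_fv (chi : so_formula) : seq nat :=
  match chi with
  | SOEq x y => [:: x; y]
  | SORel X xs => val xs
  | SOFalse => [::]
  | SOImp chi1 chi2 => so_fv chi1 ++ so_fv chi2
  | SOAll x chi1 => [seq y <- so_fv chi1 | y != x]
  | SOAllRel _ chi1 => so_fv chi1
  end.

Fixpoint so_fvrel (chi : so_formula) : seq relvar :=
  match chi with
  | SOEq _ _ | SOFalse => [::]
  | SORel X _ => [:: X]
  | SOImp chi1 chi2 => so_fvrel chi1 ++ so_fvrel chi2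
  | SOAll _ chi1 => so_fvrel chi1
  | SOAllRel X chi1 => [seq Y <- so_fvrel chi1 | Y != X]
  end.

Definition so_sentence (chi : so_formula) : Prop :=
  so_fv chi = [::] /\ so_fvrel chi = [::].

Definition relassign (K : Type) : Type := forall X : relvar, set (X.1.-tuple K).

Fixpoint so_sat (K : Type) (e : nat -> K) (s : relassign K)
    (chi : so_formula) : Prop :=
  match chi with
  | SOEq x y => e x = e y
  | SORel X xs => s X (map_tuple e xs)
  | SOFalse => False
  | SOImp chi1 chi2 => so_sat e s chi1 -> so_sat e s chi2
  | SOAll x chi1 => forall a : K, so_sat [eta e with x |-> a] s chi1
  | SOAllRel X chi1 =>
      forall A : set (X.1.-tuple K), so_sat e (dfwith s A) chi1
  end.

(* For a sentence and nonempty K the assignments are irrelevant.              *)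
Definition so_theory (K : Type) : set so_formula :=
  [set chi | so_sentence chi /\
             forall (e : nat -> K) (s : relassign K), so_sat e s chi].

Inductive grp_term : Type :=
| GVar of nat
| GOne
| GMul of grp_term & grp_term
| GInv of grp_term.

Inductive fo_formula : Type :=
| FOEq of grp_term & grp_term
| FOFalse
| FOImp of fo_formula & fo_formula
| FOAll of nat & fo_formula.

Fixpoint grp_term_fv (t : grp_term) : seq nat :=
  match t with
  | GVar x => [:: x]
  | GOne => [::]
  | GMul t1 t2 => grp_term_fv t1 ++ grp_term_fv t2
  | GInv t1 => grp_term_fv t1
  end.

Fixpoint fo_fv (theta : fo_formula) : seq nat :=
  match theta with
  | FOEq t1 t2 => grp_term_fv t1 ++ grp_term_fv t2
  | FOFalse => [::]
  | FOImp theta1 theta2 => fo_fv theta1 ++ fo_fv theta2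
  | FOAll x theta1 => [seq y <- fo_fv theta1 | y != x]
  end.

Definition fo_sentence (theta : fo_formula) : Prop := fo_fv theta = [::].

Fixpoint grp_eval (G : groupType) (e : nat -> G) (t : grp_term) : G :=
  match t with
  | GVar x => e x
  | GOne => 1
  | GMul t1 t2 => grp_eval e t1 * grp_eval e t2
  | GInv t1 => (grp_eval e t1)^-1
  end.

Fixpoint fo_sat (G : groupType) (e : nat -> G) (theta : fo_formula) : Prop :=
  match theta with
  | FOEq t1 t2 => grp_eval e t1 = grp_eval e t2
  | FOFalse => False
  | FOImp theta1 theta2 => fo_sat e theta1 -> fo_sat e theta2
  | FOAll x theta1 => forall a : G, fo_sat [eta e with x |-> a] theta1
  end.

Definition fo_theory (G : groupType) : set fo_formula :=
  [set theta | fo_sentence theta /\ forall e : nat -> G, fo_sat e theta].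

Definition free_basis (F : groupType) (B : set F) : Prop :=
  forall (H : groupType) (f : F -> H),
    exists g : {multiplicative F -> H},
      (forall x, B x -> g x = f x) /\
      (forall g' : {multiplicative F -> H},
         (forall x, B x -> g' x = f x) -> g' =1 g).

(* The cardinal is represented by any type K of that cardinality.             *)
Definition free_of_rank (F : groupType) (K : Type) : Prop :=
  exists2 B : set F, free_basis B & (B #= [set: K])%card.

Section AutomorphismGroup.
Variable F : groupType.

Record aut : Type := Aut {
  aut_fun :> F -> F;
  aut_funP : `[< {morph aut_fun : x y / x * y} /\ bijective aut_fun >]
}.

HB.instance Definition _ := [isSub for aut_fun].
HB.instance Definition _ := [Choice of aut by <:].

Lemma aut_morph (f : aut) : {morph f : x y / x * y}.
Proof. by case: f => f /= /asboolP[]. Qed.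

Lemma aut_bij (f : aut) : bijective f.
Proof. by case: f => f /= /asboolP[]. Qed.

Lemma aut_eqP (f g : aut) : f =1 g -> f = g.
Proof. by move=> fg; apply/val_inj/funext. Qed.

Fact aut_one_subproof :
  `[< {morph @idfun F : x y / x * y} /\ bijective (@idfun F) >].
Proof. by apply/asboolP; split=> //; exists idfun. Qed.

Definition aut_one : aut := Aut aut_one_subproof.

Fact aut_mul_subproof (f g : aut) :
  `[< {morph f \o g : x y / x * y} /\ bijective (f \o g) >].
Proof.
apply/asboolP; split; last by apply: bij_comp; exact: aut_bij.
by move=> x y /=; rewrite !aut_morph.
Qed.

Definition aut_mul (f g : aut) : aut := Aut (aut_mul_subproof f g).

Lemma aut_inv_exists (f : aut) :
  exists g : aut, cancel f g /\ cancel g f.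
Proof.
have [g fK gK] := aut_bij f.
have gP : `[< {morph g : x y / x * y} /\ bijective g >].
  apply/asboolP; split; last by exists f.
  by move=> x y; apply: (canLR fK); rewrite aut_morph !gK.
by exists (Aut gP).
Qed.

Definition aut_inv (f : aut) : aut := projT1 (cid (aut_inv_exists f)).

Lemma aut_invK (f : aut) : cancel f (aut_inv f) /\ cancel (aut_inv f) f.
Proof. exact: projT2 (cid (aut_inv_exists f)). Qed.

Fact aut_mulA : associative aut_mul.
Proof. by move=> f g h; apply: aut_eqP. Qed.

Fact aut_mul1 : left_id aut_one aut_mul.
Proof. by move=> f; apply: aut_eqP. Qed.

Fact aut_1mul : right_id aut_one aut_mul.
Proof. by move=> f; apply: aut_eqP. Qed.

Fact aut_mulV : left_inverse aut_one aut_inv aut_mul.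
Proof. by move=> f; apply: aut_eqP => x /=; rewrite (aut_invK f).1. Qed.

Fact aut_mulVr : right_inverse aut_one aut_inv aut_mul.
Proof. by move=> f; apply: aut_eqP => x /=; rewrite (aut_invK f).2. Qed.

HB.instance Definition _ :=
  isGroup.Build aut aut_mulA aut_mul1 aut_1mul aut_mulV aut_mulVr.

End AutomorphismGroup.

(* Main.v *)
(* Inner automorphisms are first-order definable in Aut(F).  Nontrivial elements of a
   free group have abelian centralizers, so the commutators [p, s] of an inner p
   satisfy transitivity of commutation.  If p is not inner, choose non-commuting
   u, v of the form p(x) x^-1 and an automorphism s fixing u, v and their p-preimages
   but not commuting with p: then [p, s] commutes with the inner automorphisms of u
   and of v, which are themselves commutators of p, and transitivity fails.  Hence F,
   with the action of Aut(F), is interpretable in Aut(F).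

   The domain of the interpretation of second-order logic is F itself, which has
   cardinal K.  A relation R on F is coded by finitely many automorphisms: some of
   them single out a subset Y of a basis, the others map y in Y to y r_1, ..., y r_n,
   where (r_1, ..., r_n) runs over R.  Basis elements carry levels in nat, and y only
   represents tuples of elements of lower level, which makes y |-> y r_k invertible.

   Conversely, being a free group of rank K is a second-order property of a binary
   operation on K, by the universal property restricted to groups with carrier K. *)

Require Import Defs.
From HB Require Import structures.
From mathcomp Require Import all_boot.
From mathcomp Require Import boolp classical_sets functions cardinality.

Set Implicit Arguments.
Unset Strict Implicit.
Unset Printing Implicit Defensive.

Local Open Scope classical_set_scope.

(** * Squares of infinite sets *)

(** The choice of s for a non-inner p rests on one fact: an automorphism commuting with all those
    that fix some finite set of generators is inner. A relation on F may have as many members as F,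
    while a formula has finitely many parameters and no basis of F is distinguished in Aut(F). So
    each y in Y gets a partner generator z. One automorphism inverts the generators outside Y and
    fixes only words in Y. With s exchanging y and z, and omega sending z to z y, the equation
    omega(s(u)) = s(u) u holds among these words only for u = 1 and for the letters y themselves:
    for y1 y2 the sides are z1 y1 z2 y2 and z1 z2 y1 y2. There are enough generators because F, its
    finite powers and their products with nat inject into the basis, which comes down to an
    injection of K × K into K. Conversely, no group operation on K is definable, so the translated
    sentence speaks of all operations making K a free group of rank K. They are isomorphic, hence
    agree on every first-order sentence. *)

Definition injects (T U : Type) := exists f : T -> U, injective f.

Lemma card_le_inj (T U : Type) (A : set T) (B : set U) : (A #<= B)%card -> injects A B.
Proof.
by case/card_leP => f; exists f => s t /inj; apply; exact: in_setT.
Qed.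

Lemma injects_trans (T U V : Type) : injects T U -> injects U V -> injects T V.
Proof. by move=> [f fI] [g gI]; exists (g \o f); exact: inj_comp. Qed.

Lemma injects_setT (T : Type) : injects T [set: T] /\ injects [set: T] T.
Proof.
split; last by exists val; exact: val_inj.
by exists (fun t => exist _ t (mem_set I)) => s t /(congr1 val).
Qed.

Lemma inj_inj_bij (T U : Type) (f : T -> U) (g : U -> T) :
  injective f -> injective g -> exists h : T -> U, bijective h.
Proof.
have fle (A B : Type) (h : A -> B) : injective h -> ([set: A] #<= [set: B])%card.
  move=> hI; have [k] : $|{injfun [set: A] >-> [set: B]}|.
    by apply/injfunPex; exists h => // x y _ _; exact: hI.
  exact: inj_card_le k.
move=> /fle fl /fle gl; have := Cantor_Bernstein fl gl.
case/card_eqP => h.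
exists (fun t => val (h (exist _ t (mem_set I)))).
have [k hK kK] : bijective h := bijTT.
exists (fun u => val (k (exist _ u (mem_set I)))) => x.
  have -> : exist _ (val (h (exist _ x (mem_set I)))) (mem_set I) = h (exist _ x (mem_set I)).
    exact: val_inj.
  by rewrite hK.
have -> : exist _ (val (k (exist _ x (mem_set I)))) (mem_set I) = k (exist _ x (mem_set I)).
  exact: val_inj.
by rewrite kK.
Qed.

Section Comparability.
Variables (T U : Type) (A : set T) (B : set U).

Let partial (R : set (T * U)) :=
  [/\ forall x y, R (x, y) -> A x /\ B y,
      forall x y y', R (x, y) -> R (x, y') -> y = y'
    & forall x x' y, R (x, y) -> R (x', y) -> x = x'].

(** A maximal partial injection between A and B, given by Zorn, exhausts one of the two sides, since
    otherwise a further pair could be added. Values in [option] avoid a default element of a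
    possibly empty type. *)
Lemma inj_total :
  (exists2 f : T -> option U, (forall x, A x -> exists2 y, B y & f x = Some y)
      & {in A &, injective f}) \/
  (exists2 f : U -> option T, (forall x, B x -> exists2 y, A y & f x = Some y)
      & {in B &, injective f}).
Proof.
have [G Gpart Gtot|R [[RAB Rf Ri] Rmax]] := @Zorn_bigcup _ partial.
  split=> [x y [X GX Xxy]|x y y' [X GX Xx] [Y GY Yx]|x x' y [X GX Xx] [Y GY Yx]].
  - by have [h _ _] := Gpart _ GX; exact: h.
  - by have [h|h] := Gtot _ _ GX GY; [have [_ f _] := Gpart _ GY|have [_ f _] := Gpart _ GX];
      apply: f; try exact: Xx; try exact: Yx; apply: h.
  - by have [h|h] := Gtot _ _ GX GY; [have [_ _ f] := Gpart _ GY|have [_ _ f] := Gpart _ GX];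
      apply: f; try exact: Xx; try exact: Yx; apply: h.
have [Adom|] := pselect (forall x, A x -> exists y, R (x, y)).
  left; exists (fun x => if pselect (exists y, R (x, y)) is left h then Some (sval (cid h))
                         else None).
    move=> x /Adom h; case: pselect => // h'; case: cid => /= y Rxy.
    by exists y => //; have [] := RAB _ _ Rxy.
  move=> x x' /set_mem/Adom h /set_mem/Adom h'.
  case: pselect => // {}h; case: pselect => // {}h'.
  case: cid => y Ry; case: cid => y' Ry' [e].
  by apply: Ri Ry _; rewrite /= in e; rewrite e.
move/existsNP => [x0 /not_implyP[Ax0 nx0]].
have [Bdom|] := pselect (forall y, B y -> exists x, R (x, y)).
  right; exists (fun y => if pselect (exists x, R (x, y)) is left h then Some (sval (cid h))
                         else None).
    move=> y /Bdom h; case: pselect => // h'; case: cid => /= x Rxy.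
    by exists x => //; have [] := RAB _ _ Rxy.
  move=> y y' /set_mem/Bdom h /set_mem/Bdom h'.
  case: pselect => // {}h; case: pselect => // {}h'.
  case: cid => x Rx; case: cid => x' Rx' [e].
  by apply: Rf Rx _; rewrite /= in e; rewrite e.
move/existsNP => [y0 /not_implyP[By0 ny0]].
exfalso; apply: (Rmax (R `|` [set (x0, y0)])).
  rewrite properEneq; split; last by move=> ?; left.
  apply/eqP => e; apply: nx0; exists y0; rewrite e; by right.
split=> [x y [/RAB//|[-> ->]//]|x y y' [Rx|[ex ey]] [Ry|[ex' ey']]
        |x x' y [Rx|[ex ey]] [Ry|[ex' ey']]].
- exact: Rf Rx Ry.
- by case: nx0; exists y; rewrite -ex'.
- by case: nx0; exists y'; rewrite -ex.
- by rewrite ey ey'.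
- exact: Ri Rx Ry.
- by case: ny0; exists x; rewrite -ey'.
- by case: ny0; exists x'; rewrite -ey.
- by rewrite ex ex'.
Qed.

End Comparability.

Section Square.
Variable K : Type.
Hypothesis Kinf : infinite_set [set: K].

(** [G] is the graph of a partial pairing function, whose field is read off the diagonal. Under [wf]
    it is an injection of A × A into A with A = [fld G]. *)
Let fld (G : set (K * K * K)) : set K := fun a => exists z, G (a, a, z).
Let wf (G : set (K * K * K)) :=
  [/\ forall a b z z', G (a, b, z) -> G (a, b, z') -> z = z',
      forall a b a' b' z, G (a, b, z) -> G (a', b', z) -> a = a' /\ b = b',
      forall a b, fld G a -> fld G b -> exists z, G (a, b, z)
    & forall a b z, G (a, b, z) -> [/\ fld G a, fld G b & fld G z]].

(** Zorn also calls for the union of the empty chain, which is empty. Keeping [G0] apart from X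
    makes that union acceptable and lets every field contain that of [G0]. *)
Let wf_bigcup (G0 : set (K * K * K)) (C : set (set (K * K * K))) : wf G0 ->
  C `<=` [set X | wf (G0 `|` X)] -> total_on C subset ->
  wf (G0 `|` \bigcup_(X in C) X).
Proof.
move=> wG0 Cwf Ctot; set U := _ `|` _.
pose D := [set G0 `|` X | X in C] `|` [set G0].
have Dwf X : D X -> wf X by move=> [[Y /Cwf YC <-//]|->].
have DU X : D X -> X `<=` U.
  move=> [[Y YC <-]|->] x; last by left.
  by case=> [?|Yx]; [left|right; exists Y].
have UD2 p q : U p -> U q -> exists2 X, D X & X p /\ X q.
  move=> [Gp|[X CX Xp]] [Gq|[Y CY Yq]].
  - by exists G0; [right|].
  - by exists (G0 `|` Y); [left; exists Y|split; [left|right]].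
  - by exists (G0 `|` X); [left; exists X|split; [right|left]].
  - have [h|h] := Ctot _ _ CX CY.
      by exists (G0 `|` Y); [left; exists Y|split; right=> //; exact: h].
    by exists (G0 `|` X); [left; exists X|split; right=> //; exact: h].
have fldU X : D X -> fld X `<=` fld U by move=> /DU h a [z /h]; exists z.
split.
- move=> a b z z' Uz Uz'; have [X /Dwf [f _ _ _] [Xz Xz']] := UD2 _ _ Uz Uz'.
  exact: f Xz Xz'.
- move=> a b a' b' z Uz Uz'; have [X /Dwf [_ f _ _] [Xz Xz']] := UD2 _ _ Uz Uz'.
  exact: f Xz Xz'.
- move=> a b [z Uz] [z' Uz']; have [X DX [Xz Xz']] := UD2 _ _ Uz Uz'.
  have [_ _ f _] := Dwf _ DX; have [||y Xy] := f a b; [by exists z|by exists z'|].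
  by exists y; exact: DU Xy.
- move=> a b z Uz; have [X DX [Xz _]] := UD2 _ _ Uz Uz.
  have [_ _ _ f] := Dwf _ DX; have [? ? ?] := f _ _ _ Xz.
  by split; exact: (fldU _ DX).
Qed.

(** Pairs of old elements keep their codes in A, while every new pair is coded in A', so old and new
    codes never collide. *)
Let wf_extend (A : set K) (h : K -> K -> K) (G : set (K * K * K)) (A' : set K) :
  wf G -> fld G = A -> A `&` A' = set0 ->
  (forall a b, (A `|` A') a -> (A `|` A') b -> ~ (A a /\ A b) -> A' (h a b)) ->
  (forall a b a' b', (A `|` A') a -> (A `|` A') b -> ~ (A a /\ A b) ->
     (A `|` A') a' -> (A `|` A') b' -> ~ (A a' /\ A b') -> h a b = h a' b' ->
     a = a' /\ b = b') ->
  wf (G `|` [set p | [/\ (A `|` A') p.1.1, (A `|` A') p.1.2, ~ (A p.1.1 /\ A p.1.2)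
                       & p.2 = h p.1.1 p.1.2]]).
Proof.
move=> [Gf Gi Gt Gw] eA AA' hA' hi; set H := _ `|` _.
have AA'N x : A x -> A' x -> False.
  by move=> Ax A'x; have : (A `&` A') x by []; rewrite AA'.
have GA a b z : G (a, b, z) -> [/\ A a, A b & A z].
  by rewrite -eA; exact: Gw.
have fldH a : (A `|` A') a -> fld H a.
  case=> [|A'a]; first by rewrite -eA => -[z Gz]; exists z; left.
  have nA : ~ A a by move/AA'N; apply.
  by exists (h a a); right; split => /=; [right|right|case|].
have HA a b z : H (a, b, z) -> (A `|` A') a /\ (A `|` A') b.
  by case=> [/GA[? ? _]|[]//]; split; left.
split.
- move=> a b z z' [Gz|[/= ua ub n ez]] [Gz'|[/= ua' ub' n' ez']].
  + exact: Gf Gz Gz'.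
  + by case: n'; have [? ?] := GA _ _ _ Gz.
  + by case: n; have [? ?] := GA _ _ _ Gz'.
  + by rewrite ez ez'.
- move=> a b a' b' z [Gz|[/= ua ub n ez]] [Gz'|[/= ua' ub' n' ez']].
  + exact: Gi Gz Gz'.
  + by have [_ _ /AA'N []] := GA _ _ _ Gz; rewrite ez'; exact: hA'.
  + by have [_ _ /AA'N []] := GA _ _ _ Gz'; rewrite ez; exact: hA'.
  + by apply: hi => //; rewrite -ez.
- move=> a b [z /HA[ua _]] [z' /HA[ub _]].
  have [[Aa Ab]|n] := pselect (A a /\ A b).
    by have [||y Gy] := Gt a b; rewrite ?eA //; exists y; left.
  by exists (h a b); right.
- move=> a b z Hz; have [ua ub] := HA _ _ _ Hz.
  split; [exact: fldH|exact: fldH|apply: fldH].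
  case: Hz => [/GA[_ _ ?]|[/= ? ? n ->]]; first by left.
  by right; exact: hA'.
Qed.

Lemma infinite_square : exists f : K * K -> K, injective f.
Proof.
have [j jI] : injects nat K.
  have /infiniteP/card_le_inj h := Kinf.
  apply: injects_trans (injects_setT nat).1 _.
  exact: injects_trans h (injects_setT K).2.
pose G0 : set (K * K * K) :=
  [set p | exists m n, p = (j m, j n, j (pickle (m, n)))].
have fld0 a : fld G0 a <-> exists m, a = j m.
  split=> [[z [m [n [-> _ _]]]]|[m ->]]; first by exists m.
  by exists (j (pickle (m, m))), m, m.
have wG0 : wf G0.
  split.
  - by move=> a b z z' [m [n [-> -> ->]]] [m' [n' [/jI <- /jI <- ->]]].
  - move=> a b a' b' z [m [n [-> -> ->]]] [m' [n' [-> -> /jI e]]].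
    by have [-> ->] := pcan_inj pickleK e.
  - move=> a b /fld0[m ->] /fld0[n ->].
    by exists (j (pickle (m, n))), m, n.
  - by move=> a b z [m [n [-> -> ->]]]; split; apply/fld0; eexists.
have [X [wX Xmax]] :=
  @Zorn_bigcup _ [set X | wf (G0 `|` X)] (fun C => @wf_bigcup G0 C wG0).
set G := G0 `|` X in wX; have [Gf Gi Gt Gw] := wX.
pose A := fld G.
have Aj m : A (j m).
  have [z G0z] : fld G0 (j m) by apply/fld0; exists m.
  by exists z; left.
pose f a b := if pselect (exists z, G (a, b, z)) is left e then sval (cid e) else a.
have fG a b : A a -> A b -> G (a, b, f a b).
  move=> Aa Ab; rewrite /f; case: pselect => [e|[]]; last exact: Gt.
  by case: cid.
have fA a b : A a -> A b -> A (f a b).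
  by move=> Aa Ab; have [] := Gw _ _ _ (fG _ _ Aa Ab).
have fI a b a' b' : A a -> A b -> A a' -> A b' -> f a b = f a' b' ->
    a = a' /\ b = b'.
  move=> Aa Ab Aa' Ab' e; apply: (Gi _ _ _ _ (f a b)); first exact: fG.
  by rewrite e; exact: fG.
(* If the complement of A injects into A, then so does K, and the pairing of A carries K × K along.
   Otherwise A has a disjoint copy A', and [G] extends to their union, against maximality. *)
have [[g gA gI]|[g gA gI]] := inj_total A (~` A); last first.
  pose gg x := odflt x (g x).
  have ggA x : ~ A x -> A (gg x) by rewrite /gg => /gA[y Ay ->].
  have ggI x y : ~ A x -> ~ A y -> gg x = gg y -> x = y.
    move=> nx ny; rewrite /gg; have [x' _ ex] := gA _ nx; have [y' _ ey] := gA _ ny.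
    rewrite ex ey /= => e; apply: gI; rewrite ?inE //; by rewrite ex ey e.
  pose e x := if pselect (A x) is left _ then f (j 0) x else f (j 1) (gg x).
  have eA x : A (e x) by rewrite /e; case: pselect => [Ax|nx]; apply: fA => //; exact: ggA.
  have eI x y : e x = e y -> x = y.
    rewrite /e; case: pselect => [Ax|nx]; case: pselect => [Ay|ny].
    - by move/fI => [] //.
    - by move/fI => [] //; [exact: ggA|move/jI].
    - by move/fI => [] //; [exact: ggA|move/jI].
    - move/fI => [] //; [exact: ggA|exact: ggA|move=> _; exact: ggI].
  exists (fun p => f (e p.1) (e p.2)) => -[a b] [a' b'] /= /fI[] //.
  by move=> /eI -> /eI ->.
exfalso.
pose gg x := odflt x (g x).
have ggA x : A x -> ~ A (gg x) by rewrite /gg => /gA[y Ay ->].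
have ggI x y : A x -> A y -> gg x = gg y -> x = y.
  move=> nx ny; rewrite /gg; have [x' _ ex] := gA _ nx; have [y' _ ey] := gA _ ny.
  rewrite ex ey /= => e; apply: gI; rewrite ?inE //; by rewrite ex ey e.
pose A' := gg @` A.
have AA' : A `&` A' = set0.
  by apply/seteqP; split=> // x [Ax [y Ay e]]; apply: (ggA y) => //; rewrite e.
pose u x := if pselect (exists2 a, A a & gg a = x) is left e then s2val (cid2 e) else x.
have uA x : (A `|` A') x -> A (u x).
  rewrite /u; case: pselect => [e _|n [//|[a Aa e]]]; first by case: cid2.
  by case: n; exists a.
have ugg x : A' x -> gg (u x) = x.
  by rewrite /u => A'x; case: pselect => // e; case: cid2.
have uid x : A x -> u x = x.
  rewrite /u => Ax; case: pselect => // -[a Aa e].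
  by case: (ggA a Aa); rewrite e.
have uI x y : (A x <-> A y) -> (A `|` A') x -> (A `|` A') y -> u x = u y -> x = y.
  move=> xy [Ax|A'x]; first by have Ay := xy.1 Ax; rewrite !uid.
  case=> [/xy Ax|A'y e]; last by rewrite -(ugg x) // e ugg.
  by have : (A `&` A') x by []; rewrite AA'.
(* [u] sends A' back to A and so forgets on which side an element lies; [tag] restores this, with
   one value for each of the three kinds of new pairs. *)
pose tag a b := if pselect (A a) then j 0 else if pselect (A b) then j 1 else j 2.
have tagA a b : A (tag a b) by rewrite /tag; do ?case: pselect => ?; exact: Aj.
have tagP a b a' b' : ~ (A a /\ A b) -> ~ (A a' /\ A b') -> tag a b = tag a' b' ->
    (A a <-> A a') /\ (A b <-> A b').
  move=> n n'; rewrite /tag.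
  by case: pselect => a1; case: pselect => a2; do ?case: pselect => a3;
    do ?case: pselect => a4; move/jI => // _; split; split => // ?; exfalso; tauto.
pose h a b := gg (f (tag a b) (f (u a) (u b))).
have hA' a b : (A `|` A') a -> (A `|` A') b -> ~ (A a /\ A b) -> A' (h a b).
  move=> ua ub _; exists (f (tag a b) (f (u a) (u b))) => //.
  exact: (fA _ _ (tagA _ _) (fA _ _ (uA _ ua) (uA _ ub))).
have hI a b a' b' : (A `|` A') a -> (A `|` A') b -> ~ (A a /\ A b) ->
     (A `|` A') a' -> (A `|` A') b' -> ~ (A a' /\ A b') -> h a b = h a' b' ->
     a = a' /\ b = b'.
  move=> ua ub n ua' ub' n'; have := (uA _ ua, uA _ ub, uA _ ua', uA _ ub').
  move=> [[[va vb] va'] vb'] /ggI e.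
  have fa := fA _ _ va vb; have fa' := fA _ _ va' vb'.
  have [et] := fI _ _ _ _ (tagA a b) fa (tagA a' b') fa'
    (e (fA _ _ (tagA _ _) fa) (fA _ _ (tagA _ _) fa')).
  case/fI => // eua eub; have [ta tb] := tagP _ _ _ _ n n' et.
  by split; apply: uI.
have wH := wf_extend wX (erefl A) AA' hA' hI; set E := [set p | _] in wH.
apply: (Xmax (X `|` E)); last by rewrite /= setUA.
have A't : A' (gg (j 0)) by exists (j 0).
have nAt : ~ A (gg (j 0)) by apply: ggA.
rewrite properEneq; split; last exact: subsetUl.
apply/eqP => eX; apply: (nAt); set t := gg (j 0).
have Et : E (t, t, h t t) by split=> /=; [right|right|case|].
have : G (t, t, h t t) by right; rewrite eX; right.
by case/Gw.
Qed.
End Square.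

(** * Cardinal arithmetic over an infinite set *)

Section InfiniteCard.
Variable K : Type.
Hypothesis Kinf : infinite_set [set: K].

Lemma injects_nat : injects nat K.
Proof.
have /infiniteP/card_le_inj h := Kinf.
apply: injects_trans (injects_setT nat).1 _.
exact: injects_trans h (injects_setT K).2.
Qed.

Lemma injects_count (T : countType) : injects T K.
Proof.
by apply: injects_trans injects_nat; exists pickle; exact: pcan_inj pickleK.
Qed.

Lemma injects_prod (T U : Type) : injects T K -> injects U K -> injects (T * U) K.
Proof.
move=> [f fI] [g gI]; have [q qI] := infinite_square Kinf.
exists (fun p => q (f p.1, g p.2)) => -[a b] [a' b'] /= /qI[/fI -> /gI ->].
by [].
Qed.

Lemma injects_seq (T : Type) : injects T K -> injects (seq T) K.
Proof.
move=> [f fI]; have [q qI] := infinite_square Kinf; have [j jI] := injects_nat.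
pose c := foldr (fun a x => q (f a, x)) (j 0).
(* The end marker [j 0] may coincide with the code of a longer list, so the length is stored too. *)
exists (fun s => q (j (size s), c s)) => s t /qI[/jI st].
elim: s t st => [|a s IHs] [|b t] //= [st] /qI[/fI -> /(IHs _ st) ->].
by [].
Qed.

Lemma injects_tuple (T : Type) n : injects T K -> injects (n.-tuple T) K.
Proof.
move=> TK; apply: injects_trans (injects_seq TK).
by exists val; exact: val_inj.
Qed.

Lemma infinite_fresh (T : eqType) : injects K T -> forall s : seq T, exists i, i \notin s.
Proof.
move=> KT s; have [j jI] := injects_trans injects_nat KT.
apply: contrapT => nall.
have {}nall x : x \in s.
  by apply: contrapT => /negP xs; apply: nall; exists x.
have: size (map j (iota 0 (size s).+1)) <= size s.
  by apply: uniq_leq_size; rewrite ?map_inj_uniq ?iota_uniq.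
by rewrite size_map size_iota ltnn.
Qed.

End InfiniteCard.

Local Open Scope group_scope.

(** * Reduced words *)

Section Words.
Variable I : choiceType.
Local Notation letter := (I * bool)%type.
Implicit Types (a b c : letter) (s t u : seq letter).

Definition linv a : letter := (a.1, ~~ a.2).
Definition adj a b : bool := b != linv a.
Definition reduced s : bool := sorted adj s.
Definition winv s := rev (map linv s).
(** Left multiplication by one letter, with the single cancellation it can cause. Words multiply by
    composing the actions of their letters, so associativity reduces to [wmul_act] instead of a
    comparison of cancellations. *)
Definition act a s :=
  if s is b :: s' then if b == linv a then s' else a :: s else [:: a].
Definition wmul s t := foldr act t s.

Lemma linvK : involutive linv.
Proof. by case=> i e; rewrite /linv /= negbK. Qed.

Lemma linv_neq a : (linv a == a) = false.
Proof. by apply/negP => /eqP/(congr1 snd) /=; case: a => i []. Qed.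

Lemma adjC a b : adj (linv b) (linv a) = adj a b.
Proof. by rewrite /adj linvK eq_sym. Qed.

Lemma reduced_cons a s :
  reduced (a :: s) = (if s is b :: _ then adj a b else true) && reduced s.
Proof. by case: s. Qed.

Lemma reduced_behead a s : reduced (a :: s) -> reduced s.
Proof. by rewrite reduced_cons => /andP[]. Qed.

Lemma reduced_cat s a b t :
  reduced (rcons s a ++ b :: t) = [&& reduced (rcons s a), adj a b & reduced (b :: t)].
Proof.
case: s => [|c s] //=; rewrite /reduced /= cat_path last_rcons /=.
by [].
Qed.

Lemma reduced_catl s t : reduced (s ++ t) -> reduced s.
Proof. by case: s => //= a s; rewrite /reduced /= cat_path => /andP[]. Qed.

Lemma reduced_catr s t : reduced (s ++ t) -> reduced t.
Proof. by elim: s => //= a s IHs /reduced_behead. Qed.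

Lemma reduced_glue s u t :
  u != [::] -> reduced (s ++ u) -> reduced (u ++ t) -> reduced (s ++ u ++ t).
Proof.
case: u => // a u _; case: s => [|b s] //.
by rewrite /reduced /= !cat_path /= !cat_path => /and3P[-> -> ->] ->.
Qed.

Lemma winv_rcons s a : winv (rcons s a) = linv a :: winv s.
Proof. by rewrite /winv map_rcons rev_rcons. Qed.

Lemma winv_cons a s : winv (a :: s) = rcons (winv s) (linv a).
Proof. by rewrite /winv /= rev_cons. Qed.

Lemma winv_cat s t : winv (s ++ t) = winv t ++ winv s.
Proof. by rewrite /winv map_cat rev_cat. Qed.

Lemma winvK : involutive winv.
Proof. by move=> s; rewrite /winv map_rev revK mapK //; exact: linvK. Qed.

Lemma reduced_winv s : reduced (winv s) = reduced s.
Proof.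
rewrite /reduced /winv rev_sorted sorted_map; apply: eq_sorted => a b /=.
exact: adjC.
Qed.

Lemma reduced_act a s : reduced s -> reduced (act a s).
Proof.
case: s => //= b s bs; case: ifPn => [_|nba]; first exact: reduced_behead bs.
by rewrite /reduced /= /adj nba.
Qed.

Lemma act_reduced a s : reduced (a :: s) -> act a s = a :: s.
Proof. by case: s => //= b s /andP[/negPf ->]. Qed.

Lemma act_linv a s : reduced s -> act a (act (linv a) s) = s.
Proof.
case: s => [|b s] /=; first by rewrite eqxx.
rewrite linvK; case: eqP => [-> as_r|_ _ /=]; first exact: act_reduced.
by rewrite eqxx.
Qed.

Lemma reduced_wmul s t : reduced t -> reduced (wmul s t).
Proof. by move=> rt; elim: s => //= a s; exact: reduced_act. Qed.

Lemma wmul_act a s u : reduced u -> wmul (act a s) u = act a (wmul s u).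
Proof.
move=> ru; case: s => //= b s; case: eqP => [->|//] /=.
by rewrite act_linv //; exact: reduced_wmul.
Qed.

Lemma wmulA s t u : reduced u -> wmul s (wmul t u) = wmul (wmul s t) u.
Proof. by move=> ru; elim: s => //= a s ->; rewrite wmul_act. Qed.

Lemma wmul_reduced s t : reduced (s ++ t) -> wmul s t = s ++ t.
Proof.
elim: s => //= a s IHs rs; rewrite IHs ?act_reduced //.
exact: reduced_behead rs.
Qed.

Lemma wmul_winv s : wmul s (winv s) = [::].
Proof.
elim/last_ind: s => //= s a IHs.
by rewrite /wmul winv_rcons -cats1 foldr_cat /= eqxx.
Qed.

Lemma mem_act a s : {subset act a s <= a :: s}.
Proof.
case: s => //= b s c; case: ifP => // _ cs; by rewrite !inE cs !orbT.
Qed.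

Lemma mem_wmul s t : {subset wmul s t <= s ++ t}.
Proof.
elim: s => //= a s IHs b /mem_act; rewrite !inE => /orP[->//|/IHs ->].
by rewrite orbT.
Qed.

(** All cancellation in a product of reduced words happens in one block w at the junction; this
    bounds how much one factor can destroy of the other. *)
Lemma wmul_split s t : reduced s -> reduced t ->
  exists s1 w t1, [/\ s = s1 ++ winv w, t = w ++ t1, wmul s t = s1 ++ t1
                   & reduced (s1 ++ t1)].
Proof.
elim/last_ind: s t => [|s a IHs] t rs rt; first by exists [::], [::], t.
have rs' : reduced s by apply: (@reduced_catl s [:: a]); rewrite cats1.
case: t rt => [|b t] rt.
  exists (rcons s a), [::], [::]; rewrite !cats0; split => //.
  by rewrite wmul_reduced cats0.
have [eba|nba] := eqVneq b (linv a).
  have [s1 [c [t1 [es et em er]]]] := IHs t rs' (reduced_behead rt).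
  exists s1, (b :: c), t1; rewrite et winv_cons; split => //.
    by rewrite es rcons_cat eba linvK.
  by rewrite -em /wmul -cats1 foldr_cat /= eba eqxx et.
exists (rcons s a), [::], (b :: t); rewrite cats0.
have r : reduced (rcons s a ++ b :: t) by rewrite reduced_cat rs rt andbT.
by split => //; rewrite wmul_reduced.
Qed.

Record fgroup : Type := FGroup { fg_word :> seq letter; fg_wordP : reduced fg_word }.
HB.instance Definition _ := [isSub for fg_word].
HB.instance Definition _ := [Choice of fgroup by <:].

Definition fg_one := @FGroup [::] isT.
Definition fg_mul (x y : fgroup) := FGroup (reduced_wmul x (fg_wordP y)).
Fact fg_inv_subproof (x : fgroup) : reduced (winv x).
Proof. by rewrite reduced_winv; exact: fg_wordP. Qed.
Definition fg_inv x := FGroup (fg_inv_subproof x).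

Fact fg_mulA : associative fg_mul.
Proof. by move=> x y z; apply: val_inj; apply: wmulA; exact: fg_wordP. Qed.
Fact fg_mul1 : left_id fg_one fg_mul.
Proof. by move=> x; apply: val_inj. Qed.
Fact fg_1mul : right_id fg_one fg_mul.
Proof.
by move=> x; apply: val_inj; rewrite /= wmul_reduced cats0 //; exact: fg_wordP.
Qed.
Fact fg_mulV : right_inverse fg_one fg_inv fg_mul.
Proof. by move=> x; apply: val_inj; exact: wmul_winv. Qed.
Fact fg_Vmul : left_inverse fg_one fg_inv fg_mul.
Proof.
move=> x; apply: val_inj; rewrite /= -[X in wmul _ X]winvK; exact: wmul_winv.
Qed.
HB.instance Definition _ :=
  isGroup.Build fgroup fg_mulA fg_mul1 fg_1mul fg_Vmul fg_mulV.

End Words.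

Arguments linv {I}.
Arguments adj {I}.
Arguments reduced {I}.
Arguments winv {I}.
Arguments wmul {I}.
Arguments act {I}.

(** * Free groups by the universal property, and normal forms *)

Definition free_on (F : groupType) (I : Type) (i : I -> F) :=
  (forall (H : groupType) (f : I -> H),
     exists2 g : F -> H, {morph g : x y / x * y} & forall x, g (i x) = f x) /\
  (forall (H : groupType) (g g' : F -> H),
     {morph g : x y / x * y} -> {morph g' : x y / x * y} ->
     (forall x, g (i x) = g' (i x)) -> g =1 g').

Lemma free_basis_on (F : groupType) (B : set F) :
  free_basis B -> free_on (fun x : B => val x).
Proof.
move=> FB; split=> [H f|H g g' gM g'M gg'].
  pose f' x := if pselect (B x) is left Bx then f (exist _ x (mem_set Bx)) else 1.
  have [g [gf _]] := FB H f'.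
  exists g => [x y|[x xB]]; first exact: gmulfM.
  have Bx : B x by exact: set_mem xB.
  rewrite /= gf // /f'; case: pselect => // Bx'.
  by congr f; apply: val_inj.
pose m := isMultiplicative.Build _ _ g gM.
pose m' := isMultiplicative.Build _ _ g' g'M.
pose G : {multiplicative F -> H} := HB.pack g m.
pose G' : {multiplicative F -> H} := HB.pack g' m'.
have [h [_ hu]] := FB H g'.
have e1 : G =1 h.
  by apply: hu => x Bx; exact: (gg' (exist _ x (mem_set Bx))).
have e2 : G' =1 h by apply: hu.
by move=> x; rewrite -[g x]/(G x) e1 -e2.
Qed.

Section Morph.
Variables (G H : groupType) (f : G -> H).
Hypothesis fM : {morph f : x y / x * y}.

Lemma morph1 : f 1 = 1.
Proof. by apply: (mulgI (f 1)); rewrite -fM !mulg1. Qed.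

Lemma morphV x : f x^-1 = (f x)^-1.
Proof. by apply/esym/mulg1_eq; rewrite -fM mulgV morph1. Qed.
End Morph.

Section Eval.
Variables (I : choiceType) (G : groupType) (f : I -> G).
Local Notation letter := (I * bool)%type.

Definition lev (a : letter) : G := if a.2 then f a.1 else (f a.1)^-1.
Definition ev (s : seq letter) : G := foldr (fun a x => lev a * x) 1 s.

Lemma lev_linv a : lev (linv a) = (lev a)^-1.
Proof. by case: a => i [] //=; rewrite /lev /= invgK. Qed.

Lemma ev_cat s t : ev (s ++ t) = ev s * ev t.
Proof. by elim: s => [|a s IHs] /=; rewrite ?mul1g // IHs mulgA. Qed.

Lemma ev_act a s : ev (act a s) = lev a * ev s.
Proof.
by case: s => //= b s; case: eqP => // ->; rewrite lev_linv mulVKg.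
Qed.

Lemma ev_wmul s t : ev (wmul s t) = ev s * ev t.
Proof. by elim: s => [|a s IHs] /=; rewrite ?mul1g // ev_act IHs mulgA. Qed.

Lemma ev_winv s : ev (winv s) = (ev s)^-1.
Proof.
elim: s => [|a s IHs]; first by rewrite /= invg1.
by rewrite winv_cons -cats1 ev_cat IHs /= mulg1 lev_linv invgM.
Qed.

End Eval.

Section FreeGroup.
Variables (I : choiceType) (F : groupType) (i0 : I -> F).
Hypothesis Ffree : free_on i0.
Local Notation letter := (I * bool)%type.
Local Notation ev := (ev i0).
Local Notation lev := (lev i0).
Implicit Types (a b c : letter) (s t : seq letter) (x y z w : F).

Fact nf_key : exists2 g : F -> fgroup I, {morph g : x y / x * y} &
  forall i, g (i0 i) = FGroup (isT : reduced [:: (i, true)]).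
Proof. exact: Ffree.1. Qed.

(** The universal property itself provides the normal form, as the morphism into the group of
    reduced words. Then [nfK] holds because evaluating the normal form is an endomorphism fixing the
    basis. *)
Definition nfg : F -> fgroup I := s2val (cid2 nf_key).
Definition nf w : seq letter := nfg w.

Lemma nfgM : {morph nfg : x y / x * y}.
Proof. exact: s2valP (cid2 nf_key). Qed.

Lemma nfg_gen i : nfg (i0 i) = FGroup (isT : reduced [:: (i, true)]).
Proof. exact: s2valP' (cid2 nf_key) i. Qed.

Lemma nf_reduced w : reduced (nf w).
Proof. exact: fg_wordP. Qed.

Lemma nfM x y : nf (x * y) = wmul (nf x) (nf y).
Proof. by rewrite /nf nfgM. Qed.

Lemma nf1 : nf 1 = [::].
Proof. by rewrite /nf (morph1 nfgM). Qed.

Lemma nfV x : nf x^-1 = winv (nf x).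
Proof. by rewrite /nf (morphV nfgM). Qed.

Lemma nfK w : ev (nf w) = w.
Proof.
apply: (Ffree.2 _ (fun x => ev (nf x)) id) => // [x y|i].
  by rewrite nfM ev_wmul.
by rewrite /nf nfg_gen /= mulg1.
Qed.

Lemma nf_lev a : nf (lev a) = [:: a].
Proof. by case: a => i []; rewrite /lev /= ?nfV /nf nfg_gen. Qed.

Lemma nf_ev_wmul s : nf (ev s) = wmul s [::].
Proof. by elim: s => [|a s IHs] /=; rewrite ?nf1 // nfM nf_lev IHs. Qed.

Lemma nf_ev s : reduced s -> nf (ev s) = s.
Proof. by move=> rs; rewrite nf_ev_wmul wmul_reduced cats0. Qed.

Lemma nf_inj : injective nf.
Proof. exact: can_inj nfK. Qed.

Lemma nf_eq1 w : nf w = [::] -> w = 1.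
Proof. by move=> e; rewrite -(nfK w) e. Qed.

Lemma morph_ext (H : groupType) (g g' : F -> H) :
    {morph g : x y / x * y} -> {morph g' : x y / x * y} ->
  (forall i, g (i0 i) = g' (i0 i)) -> g =1 g'.
Proof. exact: Ffree.2. Qed.

Lemma autE_gen (p q : aut F) : (forall i, p (i0 i) = q (i0 i)) -> p = q.
Proof. by move=> pq; apply/aut_eqP/morph_ext => //; exact: aut_morph. Qed.

(** * Elements supported on a set of generators *)

(** The subgroup generated by the [i0 i] with [P i], as a boolean condition on the normal form. *)
Definition supp (P : pred I) w := all (fun a => P a.1) (nf w).

Lemma supp_ev (P : pred I) s : all (fun a => P a.1) s -> supp P (ev s).
Proof.
move=> /allP sP; apply/allP => a; rewrite nf_ev_wmul => /mem_wmul.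
by rewrite cats0; exact: sP.
Qed.

Lemma supp1 P : supp P 1. Proof. by rewrite /supp nf1. Qed.

Lemma suppM P x y : supp P x -> supp P y -> supp P (x * y).
Proof.
rewrite -{2}(nfK x) -{2}(nfK y) -ev_cat => xP yP; apply: supp_ev.
by rewrite all_cat; apply/andP.
Qed.

Lemma suppV P x : supp P x -> supp P x^-1.
Proof. by rewrite /supp nfV /winv all_rev all_map. Qed.

Lemma supp_gen (P : pred I) i : P i -> supp P (i0 i).
Proof. by rewrite /supp /nf nfg_gen /= andbT. Qed.

Lemma supp_sub (P Q : pred I) x : subpred P Q -> supp P x -> supp Q x.
Proof. by move=> PQ; apply: sub_all => a; apply: PQ. Qed.

Lemma supp_ind (P : pred I) (C : F -> Prop) :
    C 1 -> (forall x y, C x -> C y -> C (x * y)) -> (forall x, C x -> C x^-1) ->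
    (forall i, P i -> C (i0 i)) ->
  forall w, supp P w -> C w.
Proof.
move=> C1 CM CV CP w; rewrite /supp -{2}(nfK w); elim: (nf w) => //= -[i e] s IHs.
case/andP=> /= Pi /IHs Cs; apply: CM => //.
by case: e => /=; [exact: CP | apply: CV; exact: CP].
Qed.

Lemma supp_fix (P : pred I) (g g' : F -> F) w :
    {morph g : x y / x * y} -> {morph g' : x y / x * y} ->
  (forall i, P i -> g (i0 i) = g' (i0 i)) -> supp P w -> g w = g' w.
Proof.
move=> gM g'M gg'.
apply: (@supp_ind P (fun w => g w = g' w)) => [|x y ex ey|x ex|//].
- by rewrite !morph1.
- by rewrite gM ex ey g'M.
- by rewrite !morphV ?ex.
Qed.

(** * Triangular and signed-permutation automorphisms *)

Lemma aut_ofK (g h : F -> F) :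
    {morph g : x y / x * y} -> cancel g h -> cancel h g ->
  exists p : aut F, aut_fun p = g.
Proof.
move=> gM gK hK.
have gP : `[< {morph g : x y / x * y} /\ bijective g >].
  by apply/asboolP; split => //; exists h.
by exists (Aut gP).
Qed.

Section Level.
Variable l : I -> nat.
Definition below (n : nat) : pred I := fun i => (l i < n)%N.
Definition triangular (h : I -> F) := forall i, supp (below (l i)) (h i).
Definition transv (h : I -> F) (g : F -> F) :=
  {morph g : x y / x * y} /\ forall i, g (i0 i) = i0 i * h i.

Lemma transv_exists h : exists g, transv h g.
Proof. by have [g gM gi] := Ffree.1 F (fun i => i0 i * h i); exists g. Qed.

(** By induction on the level: [(h i)^-1] involves lower levels only, hence has a preimage v there,
    and g sends [i0 i * v] to [i0 i]. *)
Lemma transv_onto h g : triangular h -> transv h g ->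
  forall n w, supp (below n) w -> exists2 v, supp (below n) v & g v = w.
Proof.
move=> ht [gM gi]; elim=> [|n IHn] w.
  move=> w0; exists w => //.
  move: w0; rewrite /supp => w0; suff -> : w = 1 by rewrite morph1.
  by apply: nf_eq1; case: (nf w) w0.
apply: (@supp_ind _ (fun w => exists2 v, supp (below n.+1) v & g v = w))
  => [|x y [u uP <-] [v vP <-]|x [u uP <-]|i li].
- by exists 1; [exact: supp1 | rewrite morph1].
- by exists (u * v); [exact: suppM | exact: gM].
- by exists u^-1; [exact: suppV | exact: morphV].
have : supp (below n) (h i)^-1.
  apply: suppV; apply: (supp_sub _ (ht i)) => j lj; exact: leq_trans lj li.
case/IHn=> v vP gv; exists (i0 i * v).
  by apply: suppM; [exact: supp_gen | apply: (supp_sub _ vP) => j /leqW].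
by rewrite gM gi gv mulgK.
Qed.

Lemma transv_rinv h g : triangular h -> transv h g ->
  exists h' g', [/\ triangular h', transv h' g' & cancel g' g].
Proof.
move=> ht gt; have [gM gi] := gt.
have vP i : {v | supp (below (l i)) v & g v = (h i)^-1}.
  by apply/cid2/(transv_onto ht gt)/suppV.
pose h' i := s2val (vP i); have [g' g't] := transv_exists h'.
exists h', g'; split=> //; first by move=> i; exact: s2valP (vP i).
have [g'M g'i] := g't.
apply: (Ffree.2 _ (g \o g') id) => // [x y|i] /=; first by rewrite g'M gM.
by rewrite g'i gM gi (s2valP' (vP i)) mulgK.
Qed.

(** The right inverse of a triangular map is triangular, so it has a right inverse in turn, which
    can only be the original map. Surjectivity alone thus gives bijectivity. *)
Lemma triangular_aut h : triangular h ->
  exists p : aut F, forall i, p (i0 i) = i0 i * h i.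
Proof.
move=> ht; have [g gt] := transv_exists h.
have [h' [g' [h't g't g'K]]] := transv_rinv ht gt.
have [h'' [g'' [_ _ g''K]]] := transv_rinv h't g't.
have gK : cancel g g' by move=> x; rewrite -{1}(g''K x) g'K g''K.
have [p pg] := aut_ofK gt.1 gK g'K.
by exists p => i; rewrite pg gt.2.
Qed.

End Level.

Section Signed.
Variables (pi rho : letter -> letter).
Hypotheses (piK : cancel pi rho) (rhoK : cancel rho pi).
Hypothesis pi_linv : forall a, pi (linv a) = linv (pi a).

Lemma map_reduced s : reduced s -> reduced (map pi s).
Proof.
rewrite /reduced sorted_map; congr is_true; apply: eq_sorted => a b /=.
by rewrite /adj -pi_linv (can_eq piK).
Qed.

Lemma signed_ev (q : letter -> letter) : (forall a, q (linv a) = linv (q a)) ->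
  exists2 g : F -> F, {morph g : x y / x * y} & forall s, g (ev s) = ev (map q s).
Proof.
move=> qV; have [g gM gi] := Ffree.1 F (fun i => lev (q (i, true))).
exists g => // s; elim: s => [|[i e] s IHs] /=; first exact: morph1.
rewrite gM IHs; congr (_ * _); case: e; rewrite /lev /= ?(morphV gM) gi //.
by rewrite -(lev_linv i0) -qV.
Qed.

Lemma signed_aut : exists p : aut F, forall w, nf (p w) = map pi (nf w).
Proof.
have rho_linv a : rho (linv a) = linv (rho a).
  by apply: (canLR piK); rewrite pi_linv rhoK.
have [g gM gE] := signed_ev pi_linv; have [h hM hE] := signed_ev rho_linv.
have gK : cancel g h.
  by move=> w; rewrite -{1}(nfK w) gE hE mapK // nfK.
have hK : cancel h g.
  by move=> w; rewrite -{1}(nfK w) hE gE mapK // nfK.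
have [p pg] := aut_ofK gM gK hK; exists p => w.
by rewrite pg -{1}(nfK w) gE nf_ev // map_reduced // nf_reduced.
Qed.
End Signed.

End FreeGroup.

(** * Commutation in free groups *)

Section WordPowers.
Variable I : choiceType.
Local Notation letter := (I * bool)%type.
Implicit Types (s t u : seq letter).

Lemma drop_catl n s t : (n <= size s)%N -> drop n (s ++ t) = drop n s ++ t.
Proof.
rewrite drop_cat; case: ltngtP => // -> _.
by rewrite subnn drop0 drop_size.
Qed.

Definition wpow n u := flatten (nseq n u).

Lemma size_wpow n u : u != [::] -> (n <= size (wpow n u))%N.
Proof.
case: u => // a u _; elim: n => // n IHn.
by rewrite /= size_cat ltnS (leq_trans IHn) // leq_addl.
Qed.

Lemma wpow_comm n u s : s ++ u = u ++ s -> s ++ wpow n u = wpow n u ++ s.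
Proof.
move=> su; elim: n => [|n IHn]; first by rewrite cats0.
by rewrite /= catA su -catA IHn catA.
Qed.

Lemma wpowSr n u : wpow n.+1 u = wpow n u ++ u.
Proof. by rewrite -(@wpow_comm n u u). Qed.

Lemma comm_prefix n u s : (size s <= size (wpow n u))%N ->
  s ++ u = u ++ s -> s = take (size s) (wpow n u).
Proof.
move=> ns /(wpow_comm n)/(congr1 (take (size s))).
by rewrite take_size_cat // takel_cat.
Qed.

(* Words commuting with u are prefixes of powers of u, hence determined by their length. *)
Lemma comm_trans_word u s t : u != [::] ->
  s ++ u = u ++ s -> t ++ u = u ++ t -> s ++ t = t ++ s.
Proof.
move=> u0 su tu; set n := size (s ++ t).
rewrite (@comm_prefix n u (s ++ t)) ?size_wpow //; last first.
  by rewrite -catA tu catA su catA.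
rewrite [RHS](@comm_prefix n u (t ++ s)); first by rewrite !size_cat addnC.
  by rewrite size_cat addnC -size_cat size_wpow.
by rewrite -catA su catA tu catA.
Qed.

Lemma reduced_wpow n u : u != [::] -> reduced (u ++ u) -> reduced (wpow n u).
Proof.
move=> u0 ru; elim: n => // -[|n] IHn; first by rewrite /wpow /= cats0 (reduced_catl ru).
exact: reduced_glue.
Qed.

Lemma adj_neq (a b : letter) : a.1 != b.1 -> adj a b.
Proof. by apply: contraNneq => ->. Qed.

Lemma reduced_cat_all s t : reduced s -> reduced t ->
  (forall a b, a \in s -> b \in t -> adj a b) -> reduced (s ++ t).
Proof.
case/lastP: s => // s a; case: t => [|b t] rs rt st; first by rewrite cats0.
by rewrite reduced_cat rs rt st ?mem_rcons ?mem_head.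
Qed.

End WordPowers.

Section CommTrans.
Variables (I : choiceType) (F : groupType) (i0 : I -> F).
Hypothesis Ffree : free_on i0.
Local Notation nf := (nf Ffree).
Local Notation ev := (ev i0).
Local Notation lev := (lev i0).
Implicit Types (x y z g : F).

Lemma nf_expg y n : nf y != [::] -> reduced (nf y ++ nf y) ->
  nf (y ^+ n) = wpow n (nf y).
Proof.
move=> y0 yy; rewrite -[RHS](nf_ev Ffree) ?reduced_wpow //; congr nf.
elim: n => //= n IHn; by rewrite ev_cat (nfK Ffree) -IHn expgS.
Qed.

(** At most [size (nf x)] letters of the power can cancel against x, so the last of the
    [(size (nf x)).+1] copies of y survives. *)
Lemma mul_expg_suffix x y : nf y != [::] -> reduced (nf y ++ nf y) ->
  exists s, nf (x * y ^+ (size (nf x)).+1) = s ++ nf y.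
Proof.
move=> y0 yy; rewrite nfM nf_expg //.
have rw := reduced_wpow (size (nf x)).+1 y0 yy.
have [s1 [c [t1 [es et -> _]]]] := wmul_split (nf_reduced Ffree x) rw.
move/(congr1 (drop (size c))): et; rewrite drop_size_cat // => <-.
rewrite wpowSr drop_catl; last first.
  apply: leq_trans (size_wpow _ y0).
  by rewrite es size_cat /winv size_rev size_map leq_addl.
by exists (s1 ++ drop (size c) (wpow (size (nf x)) (nf y))); rewrite catA.
Qed.

(** For a high power y^n, the normal form of x y^n begins and ends with that of y, so x y^n and y
    multiply without cancellation and commute as words. The beginning is obtained from the end by
    passing to inverses. *)
Lemma comm_cyclic x y : nf y != [::] -> reduced (nf y ++ nf y) -> commute x y ->
  exists n, let s := nf (x * y ^+ n) in s ++ nf y = nf y ++ s /\ reduced (s ++ nf y).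
Proof.
move=> y0 yy xy; exists (size (nf x)).+1; set n := _.+1; set s := nf _.
have [s1 es1] : exists s1, s = s1 ++ nf y by exact: mul_expg_suffix.
have [s2 es2] : exists s2, s = nf y ++ s2.
  have [||s2] := @mul_expg_suffix x^-1 y^-1; rewrite ?nfV.
  - by rewrite -size_eq0 /winv size_rev size_map size_eq0.
  - by rewrite -winv_cat reduced_winv.
  rewrite /winv size_rev size_map -/(winv _) -/n => /(congr1 winv).
  rewrite -nfV invgM invgK expVgn invgK winv_cat winvK => e.
  exists (winv s2); rewrite -e /s; congr nf.
  exact: commuteX.
have rs : reduced s := nf_reduced Ffree _.
have rsy : reduced (s ++ nf y).
  by rewrite es1 -catA; apply: reduced_glue => //; rewrite -es1.
have rys : reduced (nf y ++ s).
  by rewrite es2; apply: reduced_glue => //; rewrite -es2.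
split=> //; rewrite -(wmul_reduced rsy) -(wmul_reduced rys) -!nfM; congr nf.
rewrite -mulgA -expgSr expgS !mulgA; congr (_ * _).
exact: xy.
Qed.

Lemma comm_trans_cyclic x y z : nf y != [::] -> reduced (nf y ++ nf y) ->
  commute x y -> commute y z -> commute x z.
Proof.
move=> y0 yy xy yz; have zy : commute z y by exact/esym.
have [n [sn rsn]] := comm_cyclic y0 yy xy.
have [m [sm rsm]] := comm_cyclic y0 yy zy.
have := comm_trans_word y0 sn sm.
move/(congr1 ev); rewrite !ev_cat !(nfK Ffree) => e.
have yn_z : commute (y ^+ n) z by apply/esym/commuteX.
have ym_x : commute (y ^+ m) x by apply/esym/commuteX.
have ynm : commute (y ^+ n) (y ^+ m) by apply: commuteX2.
apply: (mulIg (y ^+ n * y ^+ m)).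
transitivity (x * y ^+ n * (z * y ^+ m)).
  by rewrite !mulgA; congr (_ * _); rewrite -!mulgA; congr (_ * _); exact/esym.
rewrite e ynm !mulgA; congr (_ * _); rewrite -!mulgA; congr (_ * _).
exact: ym_x.
Qed.

(** As long as the first and the last letter are inverse to each other, a conjugation removes both;
    this stops at a cyclically reduced word. *)
Lemma cyclic_conj y : y <> 1 ->
  exists g, nf (y ^ g) != [::] /\ reduced (nf (y ^ g) ++ nf (y ^ g)).
Proof.
have [n] := ubnP (size (nf y)); elim: n y => // n IHn y sy y1.
have ry := nf_reduced Ffree y; have ey := nfK Ffree y.
case ny : (nf y) ry ey sy => [|a t] ry ey sy; first by case: y1; rewrite -ey.
case/lastP: t => [|t b] in ny ry ey sy *.
  exists 1; rewrite conjg1 ny; split => //=.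
  by rewrite /adj eq_sym linv_neq.
have [ab|nab] := boolP (adj b a).
  by exists 1; rewrite conjg1 ny; split=> //; rewrite -rcons_cons reduced_cat ry ab.
have eb : b = linv a by apply: (can_inj (@linvK I)); move: nab; rewrite negbK linvK => /eqP.
have rt : reduced t.
  by move/reduced_behead: ry; rewrite -cats1 => /reduced_catl.
have yt : y ^ (lev a) = ev t.
  rewrite -ey eb /= -cats1 ev_cat /= lev_linv mulg1 conjgE -!mulgA mulVg mulg1 mulKg.
  by [].
have yn : y ^ lev a <> 1 by move/eqP; rewrite conjg_eq1 => /eqP.
have [|g [g1 g2]] := IHn (y ^ lev a) _ yn.
  by rewrite yt nf_ev //; move: sy; rewrite /= size_rcons !ltnS => /ltnW.
by exists (lev a * g); rewrite conjgM.
Qed.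

Lemma comm_trans x y z : y <> 1 -> commute x y -> commute y z -> commute x z.
Proof.
move=> y1 xy yz; have [g [g1 g2]] := cyclic_conj y1.
have cJ u v : commute u v -> commute (u ^ g) (v ^ g).
  by move=> e; rewrite /commute -!conjMg e.
have /(congr1 (fun v => v ^ g^-1)) := comm_trans_cyclic g1 g2 (cJ _ _ xy) (cJ _ _ yz).
by rewrite -!conjMg !conjgK.
Qed.

Hypothesis I_inf : forall s : seq I, exists i, i \notin s.

Lemma fresh_letter (w : F) (A : seq I) :
  exists i, i \notin A /\ forall a, a \in nf w -> a.1 != i.
Proof.
have [i] := I_inf (A ++ map fst (nf w)); rewrite mem_cat => /norP[iA iw].
exists i; split=> // a aw; apply: contraNneq iw => <-; exact: map_f.
Qed.

(** For a generator b not occurring in y, the words y b y b^-1 and b y b^-1 y are reduced as written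
    and begin with different letters. The witness is b^-1 because [y ^ g] is g^-1 y g. *)
Lemma noncomm_conj y : y <> 1 -> exists g, ~ commute y (y ^ g).
Proof.
move=> y1; have [i [_ yi]] := fresh_letter y [::].
exists (i0 i)^-1; set b := (i, true); pose s := nf y.
have ry : reduced s := nf_reduced Ffree y.
have s0 : s != [::] by apply/eqP => /nf_eq1.
have sb a e : a \in s -> adj a (i, e) by move=> /yi ai; apply: adj_neq.
have bs a e : a \in s -> adj (i, e) a.
  by move=> /yi ai; apply: adj_neq; rewrite eq_sym.
have r1 e : reduced (s ++ [:: (i, e)]).
  by apply: reduced_cat_all => // a c sa; rewrite inE => /eqP ->; exact: sb.
have r2 e : reduced ([:: (i, e)] ++ s).
  by apply: reduced_cat_all => // a c; rewrite inE => /eqP -> sc; exact: bs.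
have r3 : reduced ([:: b] ++ s ++ [:: linv b]).
  by apply: reduced_glue s0 (r2 _) (r1 _).
have yJ : y ^ (i0 i)^-1 = ev ([:: b] ++ s ++ [:: linv b]).
  by rewrite conjgE invgK !ev_cat /= lev_linv (nfK Ffree) !mulg1.
have r4 : reduced (s ++ [:: b] ++ s ++ [:: linv b]).
  exact: (@reduced_glue _ s [:: b]) isT (r1 _) r3.
have r5 : reduced ([:: b] ++ s ++ [:: linv b] ++ s).
  apply: reduced_glue s0 (r2 _) _.
  exact: (@reduced_glue _ s [:: linv b]) isT (r1 _) (r2 _).
rewrite /commute yJ; have -> : y = ev s by rewrite (nfK Ffree).
rewrite -!ev_cat => /(congr1 nf); rewrite (nf_ev Ffree r4).
have -> : ([:: b] ++ s ++ [:: linv b]) ++ s = [:: b] ++ s ++ [:: linv b] ++ s.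
  by rewrite -!catA.
rewrite (nf_ev Ffree r5).
move/(congr1 (head b)); rewrite -/s => /= hs.
have : b \in s by case: (s) s0 hs => //= a t _ ->; rewrite mem_head.
by move=> /yi; rewrite eqxx.
Qed.

(** * Inner automorphisms *)

Fact inn_subproof g :
  `[< {morph (fun x => g * x * g^-1) : x y / x * y} /\
      bijective (fun x => g * x * g^-1) >].
Proof.
apply/asboolP; split=> [x y|]; first by rewrite !mulgA mulgVK.
exists (fun x => g^-1 * x * g) => x; last by rewrite !mulgA mulgK mulgV mul1g.
by rewrite !mulgA mulgVK mulVg mul1g.
Qed.
Definition inn g : aut F := Aut (inn_subproof g).

Lemma innE g x : inn g x = g * x * g^-1. Proof. by []. Qed.

Lemma innM g h : inn (g * h) = inn g * inn h.
Proof. by apply: aut_eqP => x /=; rewrite invgM !mulgA. Qed.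

Lemma inn1 : inn 1 = 1.
Proof. by apply: aut_eqP => x /=; rewrite invg1 mul1g mulg1. Qed.

Lemma innV g : inn g^-1 = (inn g)^-1.
Proof. exact: (morphV innM). Qed.

Lemma autVK (p : aut F) x : p^-1 (p x) = x.
Proof. exact: (aut_invK p).1. Qed.

Lemma autKV (p : aut F) x : p (p^-1 x) = x.
Proof. exact: (aut_invK p).2. Qed.

Lemma aut1E x : (1 : aut F) x = x. Proof. by []. Qed.

Lemma autM (p q : aut F) x : (p * q) x = p (q x). Proof. by []. Qed.

(** Conjugating inner automorphisms by p reproduces the action of p on F; formulas over Aut(F) speak
    of F through this identity. *)
Lemma innJ (p : aut F) g : p * inn g * p^-1 = inn (p g).
Proof.
apply: aut_eqP => x; rewrite !autM !innE !aut_morph autKV.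
by rewrite (morphV (aut_morph p)).
Qed.

Lemma inn_eq1 g : inn g = 1 -> g = 1.
Proof.
move=> g1; have gC x : commute g x.
  by apply: (mulIg g^-1); rewrite mulgK; have /(congr1 (fun p : aut F => p x)) := g1.
case: (pselect (g = 1)) => // gn1.
by have [h] := noncomm_conj gn1.
Qed.

Lemma inn_inj : injective inn.
Proof.
move=> g h gh; apply: divg1_eq; apply: inn_eq1.
by rewrite innM innV gh mulgV.
Qed.

Lemma inn_comm g h : commute (inn g) (inn h) <-> commute g h.
Proof.
by rewrite /commute -!innM; split=> [/inn_inj|->].
Qed.

End CommTrans.

(** * The substitution c -> cd on reduced words *)

Section Substitution.
Variables (I : choiceType) (c d : I).
Local Notation letter := (I * bool)%type.
Implicit Types (a b : letter) (s t : seq letter).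

Definition slet a : seq letter :=
  if a.1 == c then (if a.2 then [:: a; (d, true)] else [:: (d, false); a])
  else [:: a].
Definition sword s := flatten (map slet s).
Definition swap_letter a : letter :=
  (if a.1 == c then d else if a.1 == d then c else a.1, a.2).
Definition slast a : letter := if a == (c, true) then (d, true) else a.

(** An inserted d meets an inserted d^-1 only where c is followed by c^-1, so nothing cancels in the
    image of a reduced word free of d. [slast a] is the last letter of the image of a. *)
Lemma sword_path a t : c != d -> (forall b, b \in a :: t -> b.1 != d) ->
  path adj a t -> path adj (slast a) (sword t).
Proof.
move=> cd; elim: t a => //= b t IHt a abt /andP[ab bt].
have ad : a.1 != d by apply: abt; rewrite mem_head.
have bd : b.1 != d by apply: abt; rewrite !inE eqxx orbT.
have btd x : x \in b :: t -> x.1 != d.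
  by move=> xb; apply: abt; rewrite inE xb orbT.
have /= pt := IHt b btd bt.
have lb : adj (slast a) b.
  by rewrite /slast; case: eqP => // _; apply: adj_neq; rewrite eq_sym.
rewrite /sword /= -/(sword t) cat_path.
case: b {abt} ab bt btd bd pt lb => i e /= ab bt btd id pt lb.
rewrite /slet /=; have [ic|ic] := eqVneq i c; last first.
  by move: pt; rewrite /slast xpair_eqE (negPf ic) /= lb => ->.
rewrite ic in ab lb pt *; case: e ab bt btd pt lb => ab bt btd pt lb /=.
  by move: pt; rewrite /slast eqxx lb => ->; rewrite adj_neq.
move: pt; rewrite {1}/slast xpair_eqE andbF => ->; rewrite andbT.
rewrite [adj (d, false) _]adj_neq 1?eq_sym // andbT /slast.
case: eqP => [ea|_]; first by move: ab; rewrite ea /adj /= eqxx.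
by rewrite adj_neq.
Qed.

Lemma sword_id t : (forall b, b \in t -> b.1 != c) -> sword t = t.
Proof.
elim: t => //= b t IHt bt; rewrite /sword /= -/(sword t) IHt.
  by rewrite /slet (negPf (bt b _)) ?mem_head.
by move=> x xt; apply: bt; rewrite inE xt orbT.
Qed.

End Substitution.

(** * First-order criterion for inner automorphisms *)

Section InnerCriterion.
Variables (I : choiceType) (F : groupType) (i0 : I -> F).
Hypothesis Ffree : free_on i0.
Hypothesis I_inf : forall s : seq I, exists i, i \notin s.
Local Notation nf := (nf Ffree).
Local Notation ev := (ev i0).
Local Notation lev := (lev i0).
Implicit Types (x y z g : F).

Lemma elementary_aut c y : supp Ffree (predC1 c) y ->
  exists p : aut F, p (i0 c) = i0 c * y /\ forall i, i != c -> p (i0 i) = i0 i.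
Proof.
move=> yc; pose l (i : I) : nat := i == c.
pose h i := if i == c then y else 1.
have ht : triangular Ffree l h.
  move=> i; rewrite /h /l; case: eqP => _; last exact: supp1.
  by apply: (supp_sub _ yc) => j; rewrite /below /= => /negPf ->.
have [p pE] := triangular_aut ht; exists p; rewrite pE /h eqxx; split=> // i ic.
by rewrite pE /h (negPf ic) mulg1.
Qed.

Lemma ev_sword c d (p : aut F) s : p (i0 c) = i0 c * i0 d ->
  (forall i, i != c -> p (i0 i) = i0 i) -> p (ev s) = ev (sword c d s).
Proof.
move=> pc pi; elim: s => [|[i e] s IHs]; first exact: (morph1 (aut_morph p)).
rewrite /= aut_morph IHs /sword /= -/(sword c d s) ev_cat; congr (_ * _).
rewrite /lev /slet /=; case: eqP => [->|/eqP ic].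
  case: e; rewrite /= /lev /= mulg1 //.
  by rewrite (morphV (aut_morph p)) pc invgM.
by case: e; rewrite /= /lev /= mulg1 ?(morphV (aut_morph p)) pi.
Qed.

Lemma swap_aut c d : exists p : aut F, forall w,
  nf (p w) = map (swap_letter c d) (nf w).
Proof.
set q := swap_letter c d.
have qK : involutive q.
  case=> i e; rewrite /q /swap_letter /=; congr (_, _).
  have [->|ic] := eqVneq i c; first by rewrite eqxx; case: eqP.
  by have [->|id] := eqVneq i d; rewrite ?eqxx // (negPf ic) (negPf id).
by apply: (signed_aut Ffree qK qK); case.
Qed.

(* The image w of a fresh generator c satisfies w(cd) = w(c) w(d), which forces
   w = g c g^-1 with g free of c. *)
Lemma fresh_image (p : aut F) (A : seq I) c : c \notin A ->
    (forall q : aut F, (forall i, i \in A -> q (i0 i) = i0 i) -> commute q p) ->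
  exists2 g, supp Ffree (predC1 c) g & p (i0 c) = g * i0 c * g^-1.
Proof.
move=> cA pA; set w := p (i0 c).
(* With d new as well, q : c -> cd and the swap r of c and d both fix A and so commute with p. Hence
   q(w) = w p(d) and p(d) = r(w), and the latter has no letter c because w has no d. *)
have [d []] := fresh_letter Ffree I_inf w (c :: A).
rewrite inE => /norP[dc dA] wd.
have cd : c != d by rewrite eq_sym.
have [q [qc qi]] := @elementary_aut c (i0 d) (supp_gen Ffree dc).
have qp : commute q p.
  by apply: pA => i iA; apply: qi; apply: contraNneq cA => <-.
have [r rE] := swap_aut c d; 
have rgen i : r (i0 i) = i0 (if i == c then d else if i == d then c else i).
  apply: (nf_inj (Ffree := Ffree)); rewrite rE /nf !nfg_gen /=.
  by [].
have rp : commute r p.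
  apply: pA => i iA; rewrite rgen.
  have -> : (i == c) = false by apply: contraNF cA => /eqP <-.
  by have -> : (i == d) = false by apply: contraNF dA => /eqP <-.
have pd : p (i0 d) = r w.
  have := congr1 (fun f : aut F => f (i0 c)) rp.
  by rewrite !autM rgen eqxx.
have qw : q w = w * p (i0 d).
  have := congr1 (fun f : aut F => f (i0 c)) qp.
  by rewrite !autM qc aut_morph.
have nopd a : a \in nf (p (i0 d)) -> a.1 != c.
  rewrite pd rE => /mapP[b /wd bd ->] /=.
  by case: (eqVneq b.1 c) => // bc; rewrite (negPf bd).
set s := nf w in wd rE *; have rs : reduced s := nf_reduced Ffree w.
have es : w = ev s by rewrite (nfK Ffree).
have [cs|/hasPn noc] := boolP (has (fun a => a.1 == c) s); last first.
  have : q w = w by rewrite es (ev_sword _ qc qi) sword_id.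
  rewrite qw => /(congr1 (fun x => w^-1 * x)); rewrite mulKg mulVg => pd1.
  have : i0 d = 1 by rewrite -(autVK p (i0 d)) pd1 (morph1 (aut_morph p^-1)).
  by move/(congr1 nf); rewrite nf1 /nf nfg_gen.
(* Cut w at its first occurrence of c or c^-1: the part u0 before it is fixed by q and disappears
   from p(d) = w^-1 q(w). *)
have [u0 [a [t [eq_s ac nou0]]]] : exists u0 a t,
    [/\ s = u0 ++ a :: t, a.1 = c & forall b, b \in u0 -> b.1 != c].
  case/split_find: cs => a u0 t /eqP ac /hasPn nou0.
  by exists u0, a, t; rewrite cat_rcons.
have at_path : path adj a t by move: rs; rewrite eq_s => /reduced_catr.
have atd b : b \in a :: t -> b.1 != d.
  by move=> bat; apply: wd; rewrite eq_s mem_cat bat orbT.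
have := sword_path cd atd at_path; set S := sword c d t => Spath.
have pdE : p (i0 d) = w^-1 * q w by rewrite qw mulKg.
have qE : q w = ev u0 * (ev (slet c d a) * ev S).
  rewrite es (ev_sword _ qc qi) eq_s /sword map_cat flatten_cat /= !ev_cat.
  by rewrite -/(sword c d u0) sword_id.
have rt : reduced t by apply: path_sorted at_path.
have rat : reduced (winv t ++ [:: linv a]).
  by rewrite cats1 -winv_cons reduced_winv.
have wVE : w^-1 = ev (winv t) * (lev a)^-1 * (ev u0)^-1.
  by rewrite ev_winv es eq_s ev_cat /= !invgM.
case: a => i e /= in eq_s ac at_path atd Spath qE rat wVE *.
case: e in eq_s at_path atd Spath qE rat wVE *; subst i; last first.
  (* A first occurrence c^-1 would make p(d) = t^-1 c d^-1 c^-1 S, which is reduced and contains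
     c. *)
  pose u := winv t ++ [:: (c, true)] ++ [:: (d, false); (c, false)] ++ S.
  have uE : p (i0 d) = ev u.
    rewrite pdE qE wVE /slet /= eqxx /u !ev_cat /= /lev /= !mulg1 invgK.
    by rewrite !mulgA mulgVK.
  have ru : reduced u.
    apply: (@reduced_glue _ _ [:: _]) => //.
    rewrite /reduced /=; move: Spath; rewrite /slast xpair_eqE andbF => ->.
    by rewrite !adj_neq.
  have : (c, true) \in nf (p (i0 d)).
    by rewrite uE nf_ev // /u mem_cat mem_head orbT.
  by move/nopd; rewrite eqxx.
rewrite /slast eqxx in Spath.
have wtd b : b \in winv t -> adj b (d, true).
  rewrite /winv mem_rev => /mapP[b' b't ->]; apply: adj_neq => /=.
  by apply: atd; rewrite inE b't orbT.
(* A first occurrence c makes p(d) = t^-1 d S, again reduced; as p(d) has no c, neither has t, and S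
   = t. *)
pose u := winv t ++ [:: (d, true)] ++ S.
have uE : p (i0 d) = ev u.
  rewrite pdE qE wVE /slet /= eqxx /u !ev_cat /= /lev /= !mulg1.
  by rewrite !mulgA mulgVK mulgVK.
have ru : reduced u.
  apply: (@reduced_glue _ _ [:: _]) => //.
  apply: reduced_cat_all; rewrite ?reduced_winv // => b b' bt.
  by rewrite inE => /eqP ->; exact: wtd.
have ntc b : b \in t -> b.1 != c.
  move=> bt; apply: (nopd (linv b)); rewrite uE nf_ev // mem_cat.
  by rewrite /winv mem_rev map_f.
have St : S = t by exact: sword_id.
(* Compare r(w) = u0 d t with p(d) = t^-1 d t. *)
have u0t : ev u0 = (ev t)^-1.
  have swap_id v : {subset v <= s} -> (forall b, b \in v -> b.1 != c) ->
      map (swap_letter c d) v = v.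
    move=> vs vc; rewrite -[RHS]map_id; apply/eq_in_map => b bv.
    have bd := wd _ (vs _ bv).
    by rewrite /swap_letter (negPf (vc _ bv)) (negPf bd); case: b {bv bd}.
  have : r w = ev u0 * (i0 d * ev t).
    rewrite -(nfK Ffree (r w)) rE -/s eq_s map_cat ev_cat /= !swap_id //.
    - by rewrite /swap_letter /= eqxx.
    - by move=> b bt; rewrite eq_s mem_cat inE bt !orbT.
    - by move=> b bt; rewrite eq_s mem_cat bt.
  rewrite -pd uE /u St !ev_cat /= /lev /= mulg1 => /mulIg.
  by rewrite ev_winv.
exists (ev u0); first by apply: supp_ev; apply/allP => b /nou0.
by rewrite -/w es eq_s ev_cat u0t /= /lev /= invgK mulgA.
Qed.

(** A single new generator c yields g by [fresh_image]. For b other than c, the automorphism q : c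
    -> cb fixes A and g, and evaluating q p = p q at c forces p(b) = g b g^-1. *)
Lemma centralizer_inner (p : aut F) (A : seq I) :
    (forall q : aut F, (forall i, i \in A -> q (i0 i) = i0 i) -> commute q p) ->
  exists g, p = inn g.
Proof.
move=> pA; have [c cA] := I_inf A; have [g gc pc] := fresh_image cA pA.
exists g; apply: (autE_gen Ffree) => b; rewrite innE.
have [->//|bc] := eqVneq b c.
have [q [qc qi]] := @elementary_aut c (i0 b) (supp_gen Ffree bc).
have qp : commute q p.
  by apply: pA => i iA; apply: qi; apply: contraNneq cA => <-.
have qg : q g = g.
  by apply: (supp_fix (g' := id) (aut_morph q) _ _ gc).
have := congr1 (fun f : aut F => f (i0 c)) qp.
rewrite !autM qc aut_morph pc !aut_morph qg (morphV (aut_morph q)) qg qc.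
by rewrite -!mulgA => /mulgI/mulgI/(congr1 (fun x => g * x)); rewrite mulVKg.
Qed.

Definition cmt (G : groupType) (p s : G) := p * s * p^-1 * s^-1.

Definition inner_like (G : groupType) (p : G) := forall s1 s2 s3 : G,
  cmt p s2 <> 1 -> commute (cmt p s1) (cmt p s2) ->
  commute (cmt p s2) (cmt p s3) -> commute (cmt p s1) (cmt p s3).

Lemma cmt_inn g (s : aut F) : cmt (inn g) s = inn (g * (s g)^-1).
Proof.
rewrite /cmt -mulgA -mulgA [s * _]mulgA -innV innJ -innM.
by rewrite (morphV (aut_morph s)).
Qed.

Lemma cmt_innr g (p : aut F) : cmt p (inn g) = inn (p g * g^-1).
Proof. by rewrite /cmt innJ -innV -innM. Qed.

(** If all displacements p(x) x^-1 commute, those of hx and h show that v = p(x) x^-1 commutes with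
    p(h) v p(h)^-1. As p is onto, v commutes with all its conjugates, so v = 1. *)
Lemma displacement_noncomm (p : aut F) : p <> 1 ->
  exists x y, ~ commute (p x * x^-1) (p y * y^-1).
Proof.
move=> p1; apply/not_existsP => H.
have {}H x y : commute (p x * x^-1) (p y * y^-1).
  by apply: contrapT => nc; apply: (H x); exists y.
apply: p1; apply: aut_eqP => x; rewrite aut1E.
apply: divg1_eq; apply: contrapT => v1.
have [g] := noncomm_conj Ffree I_inf v1; apply.
set v := p x * x^-1 in v1 *.
have vh h : commute v (p h * v * (p h)^-1).
  have := commuteM (H x (h * x)) (commuteV (H x h)).
  by rewrite -/v invgM aut_morph invgM invgK !mulgA !mulgVK.
have := vh (p^-1 g^-1); rewrite autKV invgK => e.
by rewrite conjgE mulgA.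
Qed.

Theorem inner_likeP (p : aut F) : inner_like p <-> exists g, p = inn g.
Proof.
split=> [pI|[g ->] s1 s2 s3]; last first.
  rewrite !cmt_inn !(inn_comm Ffree I_inf) => n1.
  apply: (comm_trans Ffree) => e; apply: n1; by rewrite e inn1.
have [->|/eqP p1] := eqVneq p 1; first by exists 1; rewrite inn1.
have [x [y xy]] := displacement_noncomm p1.
set u := p x * x^-1 in xy; set v := p y * y^-1 in xy.
apply: (@centralizer_inner p (map fst (nf u ++ nf v ++ nf (p^-1 u) ++ nf (p^-1 v)))).
move=> q qA; apply: contrapT => nqp; apply: xy.
have qfix z : {subset nf z <= nf u ++ nf v ++ nf (p^-1 u) ++ nf (p^-1 v)} -> q z = z.
  move=> zs; apply: (supp_fix (Ffree := Ffree) (P := mem (map fst (nf z))) (g' := id)).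
  - exact: aut_morph.
  - by [].
  - by move=> i /mapP[a /zs aA ->]; apply: qA; exact: map_f.
  - by apply/allP => a az; exact: map_f.
have qV z : q z = z -> q^-1 z = z by move=> {1}<-; rewrite autVK.
have cfix z : q z = z -> q (p^-1 z) = p^-1 z -> commute (inn z) (cmt p q).
  move=> qz qpz; have cz : cmt p q z = z by rewrite /cmt !autM qV // qpz autKV.
  by apply: (mulIg (cmt p q)^-1); rewrite innJ cz mulgK.
apply/(inn_comm Ffree I_inf).
rewrite /u /v -!cmt_innr.
apply: (pI _ q); rewrite ?cmt_innr.
- move=> c1; apply: nqp; apply/esym; apply: (mulIg p^-1); apply: (mulIg q^-1).
  by move: c1; rewrite /cmt mulgK mulgV.
- by apply: cfix; apply: qfix => a; rewrite !mem_cat => ->; rewrite ?orbT.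
- by apply/esym/cfix; apply: qfix => a; rewrite !mem_cat => ->; rewrite ?orbT.
Qed.

End InnerCriterion.

(** * Coding relations on a free group by automorphisms *)

Section DefinableBasis.
Variables (I : choiceType) (F : groupType) (i0 : I -> F).
Hypothesis Ffree : free_on i0.
Local Notation nf := (nf Ffree).
Local Notation ev := (ev i0).
Local Notation lev := (lev i0).
Local Notation letter := (I * bool)%type.
Variables (Y : pred I) (z : I -> I).
Hypothesis zI : {in Y &, injective z}.
Hypothesis zY : forall y, Y y -> ~~ Y (z y).

(** The word of omega(s(a)), which is z y for a = y and y^-1 z^-1 for a = y^-1, and below it its
    last letter. *)
Let wl (a : letter) : seq letter :=
  if a.2 then [:: (z a.1, true); a] else [:: a; (z a.1, false)].
Let wlast (a : letter) : letter := if a.2 then a else (z a.1, false).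

Let zneq y y' : Y y -> Y y' -> y != z y'.
Proof. by move=> Yy Yy'; apply: contraTneq Yy => ->; exact: zY. Qed.

(** Letters of Y never cancel against letters of z(Y), while y y'^-1 or z(y)^-1 z(y') at a junction
    cancels only for y = y', when the original word would not be reduced. *)
Let path_wl a w : all (fun b => Y b.1) (a :: w) -> path adj a w ->
  path adj (wlast a) (flatten (map wl w)).
Proof.
elim: w a => //= b w IHw a /and3P[Ya Yb Yw] /andP[ab bw].
have {IHw} /(_ _ bw) pw := IHw b; rewrite Yb Yw in pw; have {}pw := pw isT.
rewrite cat_path; case: b => y [] /= in Yb ab bw pw *.
  rewrite pw !andbT [adj (z y, true) _]adj_neq ?andbT /=; last by rewrite eq_sym zneq.
  rewrite /wlast; case: a => y' [] /= in Ya ab *; first by rewrite adj_neq ?zneq.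
  rewrite /adj /linv /= xpair_eqE andbT; move: ab; rewrite /adj /linv /= xpair_eqE andbT.
  by apply: contra => /eqP/zI ->.
rewrite /wlast /= in pw *; rewrite pw !andbT [X in _ && X]adj_neq ?zneq // andbT.
case: a => y' [] /= in Ya ab *; first by [].
by rewrite adj_neq // eq_sym zneq.
Qed.

(* A reduced word u in Y with more than one letter cannot satisfy (zy)-substitution
   of u = z(u) u, since the left side alternates between z- and y-letters. *)
Lemma definable_basis (alpha s omega : aut F) :
    (forall w, nf (alpha w) = map (fun a => (a.1, if Y a.1 then a.2 else ~~ a.2)) (nf w)) ->
    (forall y, Y y -> s (i0 y) = i0 (z y)) ->
    (forall y, Y y -> omega (i0 (z y)) = i0 (z y) * i0 y) ->
  forall u, (u <> 1 /\ alpha u = u /\ omega (s u) = s u * u) <-> exists2 y, Y y & u = i0 y.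
Proof.
move=> alphaE sE omegaZ u; split; last first.
  case=> y Yy ->; rewrite sE // omegaZ //; split; last split => //.
    by move/(congr1 nf); rewrite nf1 /nf nfg_gen.
  apply: (nf_inj (Ffree := Ffree)); rewrite alphaE /nf nfg_gen /= Yy.
  by [].
case=> u1 [au ou]; set w := nf u; have rw : reduced w := nf_reduced Ffree u.
have eu : u = ev w by rewrite (nfK Ffree).
have w0 : w != [::] by apply/eqP => /nf_eq1.
(* alpha inverts exactly the letters outside Y, so it fixes no word containing one. *)
have wY : all (fun b => Y b.1) w.
  apply/allP => b bw; apply: contraT => nYb.
  have := congr1 nf au; rewrite alphaE -/w => ew.
  have /(congr1 (fun v => nth b v (index b w))) := ew.
  rewrite (nth_map b) ?index_mem // nth_index // (negPf nYb).
  by move/(congr1 snd) => /=; case: b.2.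
have sw : s u = ev (map (fun a => (z a.1, a.2)) w).
  rewrite eu; elim: (w) wY => [|[y e] v IHv] /=; first by rewrite (morph1 (aut_morph s)).
  case/andP=> Yy /IHv <-; rewrite aut_morph; congr (_ * _).
  by rewrite /lev; case: e; rewrite /= ?(morphV (aut_morph s)) sE.
have ow : omega (s u) = ev (flatten (map wl w)).
  rewrite sw; elim: (w) wY => [|[y e] v IHv] /=; first by rewrite (morph1 (aut_morph _)).
  case/andP=> Yy /IHv IHv'; rewrite ev_cat -IHv' aut_morph; congr (_ * _).
  rewrite /lev; case: e; rewrite /= ?(morphV (aut_morph _)) omegaZ //=.
    by rewrite mulg1.
  by rewrite mulg1 invgM.
have rwl : reduced (flatten (map wl w)).
  case: (w) w0 wY rw => // a v _ Yav av; have := path_wl Yav av.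
  rewrite /= /reduced; have := Yav; rewrite /= => /andP[Ya _].
  case: a {Yav av} Ya => y [] /= Ya; rewrite /wlast /= => ->; rewrite andbT.
    by rewrite adj_neq //= eq_sym zneq.
  by rewrite adj_neq //= zneq.
have rzw : reduced (map (fun a => (z a.1, a.2)) w ++ w).
  apply: reduced_cat_all => // [|a b /mapP[a' a'w ->] bw]; last first.
    by apply: adj_neq; rewrite /= eq_sym zneq // (allP wY).
  rewrite /reduced sorted_map.
  apply: (@sub_in_sorted _ [pred b | Y b.1] (@adj I)) wY rw => -[y e] [y' e'] Yy Yy'.
  rewrite /relpre /adj /linv /= !xpair_eqE; apply: contra => /andP[/eqP e1 ->].
  by rewrite andbT; apply/eqP/zI.
have ew : flatten (map wl w) = map (fun a => (z a.1, a.2)) w ++ w.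
  by rewrite -(nf_ev Ffree rwl) -ow ou sw [X in _ * X]eu -ev_cat nf_ev.
(* Both sides are normal forms, hence equal letter by letter. Unless w is a single positive letter,
   a letter of Y faces a letter of z(Y) in one of the first two places. *)
case: w eu w0 wY ew {rw sw ow rwl rzw} => // a [|b w] eu _ wY ew.
  case: a wY eu ew => y [] /=; rewrite andbT => Yy eu.
    by exists y => //; rewrite eu /= mulg1.
  by move=> [/eqP]; rewrite (negPf (zneq Yy Yy)).
exfalso; case/and3P: wY => Ya Yb _; case: a Ya eu ew => y [] /= Ya _.
  by case: b Yb => y' e /= Yb [/eqP]; rewrite (negPf (zneq Ya Yb)).
by move=> [/eqP]; rewrite (negPf (zneq Ya Ya)).
Qed.

End DefinableBasis.

Definition codes (F : groupType) n (alpha s omega : aut F) (sig : 'I_n -> aut F)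
    (t : n.-tuple F) : Prop :=
  exists u, (u <> 1 /\ alpha u = u /\ omega (s u) = s u * u) /\
            forall k, sig k u = u * tnth t k.

Section Coding.
Variables (I : choiceType) (F : groupType) (i0 : I -> F).
Hypothesis Ffree : free_on i0.
Local Notation nf := (nf Ffree).
Variable n : nat.
Let idx := ((n.-tuple F * nat) * bool)%type.

(* Basis elements are indexed by y_(t,m) and z_(t,m), with t in F^n and m a level;
   y_(t,m) represents t as soon as the letters of t have level less than m. *)
Lemma relation_codable (R : set (n.-tuple F)) : injects idx I ->
  exists (alpha s omega : aut F) (sig : 'I_n -> aut F),
    forall t, codes alpha s omega sig t <-> R t.
Proof.
case=> j jI.
(* A partial inverse of j. Generators outside the image of j get level 0, lie outside Y and are
   fixed by z. *)
pose dec i : option idx := if pselect (exists p, j p = i) is left e then Some (sval (cid e)) else None.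
have decj p : dec (j p) = Some p.
  by rewrite /dec; case: pselect => [e|[]]; [case: cid => /= q /jI ->|exists p].
have jdec i p : dec i = Some p -> j p = i.
  by rewrite /dec; case: pselect => // e; case: cid => /= q qi [<-].
pose l i := if dec i is Some (_, m, _) then m else 0.
pose used (tm : n.-tuple F * nat) : bool :=
  `[< R tm.1 /\ forall k, supp Ffree (below l tm.2) (tnth tm.1 k) >].
pose Y : pred I := fun i => if dec i is Some (tm, true) then used tm else false.
pose z i := if dec i is Some (tm, b) then j (tm, ~~ b) else i.
have YP i : Y i -> exists2 tm, used tm & i = j (tm, true).
  by rewrite /Y; case e: (dec i) => [[tm []]|] // u; exists tm; rewrite // -(jdec _ _ e).
have zj tm b : z (j (tm, b)) = j (tm, ~~ b) by rewrite /z decj.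
have zK : involutive z.
  by move=> i; rewrite {2}/z; case e: (dec i) => [[tm b]|]; [rewrite zj negbK; exact: jdec|rewrite /z e].
have zY y : Y y -> ~~ Y (z y) by move=> /YP[tm _ ->]; rewrite zj /Y decj.
have [alpha alphaE] : exists p : aut F, forall w,
    nf (p w) = map (fun a => (a.1, if Y a.1 then a.2 else ~~ a.2)) (nf w).
  have aK : involutive (fun a : I * bool => (a.1, if Y a.1 then a.2 else ~~ a.2)).
    by case=> i e /=; case: (Y i); rewrite // negbK.
  apply: (signed_aut Ffree aK aK) => -[i e]; rewrite /linv /=.
  by case: (Y i).
have [s sE] : exists p : aut F, forall w,
    nf (p w) = map (fun a => (z a.1, a.2)) (nf w).
  have sK : involutive (fun a : I * bool => (z a.1, a.2)).
    by case=> i e /=; rewrite zK.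
  by apply: (signed_aut Ffree sK sK).
have [omega omegaE] : exists p : aut F, forall i,
    p (i0 i) = i0 i * (if dec i is Some (tm, false) then i0 (j (tm, true)) else 1).
  (* omega has two levels of its own, z above y: the level [l] cannot serve, as it is m for both
     y_(t,m) and z_(t,m). *)
  apply: (triangular_aut (l := fun i => if dec i is Some (_, false) then 1%N else 0%N)
    (h := fun i => if dec i is Some (tm, false) then i0 (j (tm, true)) else 1)) => i.
  case e: (dec i) => [[tm []]|]; try exact: supp1.
  by apply: supp_gen; rewrite /below decj.
have sigP (k : 'I_n) : exists p : aut F, forall i,
    p (i0 i) = i0 i * (if dec i is Some (tm, true) then
                         if used tm then tnth tm.1 k else 1 else 1).
  apply: (triangular_aut (l := l) (h := fun i => if dec i is Some (tm, true) then
    if used tm then tnth tm.1 k else 1 else 1)) => i; rewrite [l i]/l.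
  case e: (dec i) => [[[t m] []]|]; try exact: supp1.
  case: ifP => [/asboolP[_]|_]; [exact|exact: supp1].
pose sig k := sval (cid (sigP k)).
have sigE k i : Y i -> forall tm, i = j (tm, true) -> sig k (i0 i) = i0 i * tnth tm.1 k.
  rewrite /sig => Yi tm ei; case: cid => p /= ->; move: Yi; rewrite ei /Y decj.
  by move->.
have zI : {in Y &, injective z} by move=> y y' _ _; exact: (can_inj zK).
have base u : (u <> 1 /\ alpha u = u /\ omega (s u) = s u * u) <->
    exists2 y, Y y & u = i0 y.
  apply: (definable_basis zI zY alphaE) => y /YP[tm _ ->].
  - by apply: (nf_inj (Ffree := Ffree)); rewrite sE /nf !nfg_gen.
  - by rewrite zj omegaE decj.
exists alpha, s, omega, sig => t; split.
  case=> u [/base[y Yy ->]] st; have [tm ut ey] := YP _ Yy.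
  have -> : t = tm.1 by apply: eq_from_tnth => k; apply: (mulgI (i0 y)); rewrite -st (sigE k _ Yy tm).
  by move/asboolP: ut => [].
(* Only finitely many letters occur in t, so some level m exceeds all of theirs. *)
move=> Rt; have [m tmP] : exists m, forall k, supp Ffree (below l m) (tnth t k).
  pose mk k := \max_(a <- nf (tnth t k)) (l a.1).+1.
  exists (\max_k mk k) => k; apply/allP => a ak; rewrite /below.
  apply: (leq_trans _ (leq_bigmax k)).
  by rewrite /mk (big_rem a) //= leq_maxl.
have Yy : Y (j (t, m, true)) by rewrite /Y decj; apply/asboolP.
exists (i0 (j (t, m, true))); split; first by apply/base; exists (j (t, m, true)).
by move=> k; rewrite (sigE k _ Yy (t, m)).
Qed.

End Coding.

(** * From second-order sentences to group sentences *)

Definition FONot a := FOImp a FOFalse.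
Definition FOAnd a b := FONot (FOImp a (FONot b)).
Definition FOEx x a := FONot (FOAll x (FONot a)).
Definition FOTrue := FOImp FOFalse FOFalse.
Definition fo_big_and (T : Type) (f : T -> fo_formula) (r : seq T) :=
  foldr (fun k theta => FOAnd (f k) theta) FOTrue r.

Section Connectives.
Variables (G : groupType) (e : nat -> G).

Lemma fo_sat_and a b : fo_sat e (FOAnd a b) <-> fo_sat e a /\ fo_sat e b.
Proof.
split=> /= [h|[ha hb]]; last exact.
by split; apply: contrapT => n; apply: h.
Qed.

Lemma fo_sat_ex x a : fo_sat e (FOEx x a) <-> exists u, fo_sat [eta e with x |-> u] a.
Proof.
split=> /= [h|[u hu]]; last by move=> /(_ u).
by apply: contrapT => n; apply: h => u hu; apply: n; exists u.
Qed.

Lemma fo_sat_big_and (T : eqType) (f : T -> fo_formula) r :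
  fo_sat e (fo_big_and f r) <-> forall k, k \in r -> fo_sat e (f k).
Proof.
elim: r => [|k r IHr]; first by split=> [_ k|_ []].
rewrite /fo_big_and [foldr _ _ _]/= fo_sat_and IHr; split=> [[h1 h2] l|h].
  by rewrite inE => /orP[/eqP ->|/h2].
by split=> [|l lr]; apply: h; rewrite inE ?eqxx ?lr ?orbT.
Qed.

End Connectives.

(** * Universal closure of first-order formulas *)

Definition fo_close theta := foldr FOAll theta (fo_fv theta).

Lemma fo_fv_foldr theta r : fo_fv (foldr FOAll theta r) = [seq x <- fo_fv theta | x \notin r].
Proof.
elim: r => [|y r IHr] /=; first by rewrite filter_predT.
rewrite IHr -filter_predI; apply: eq_filter => x /=.
by rewrite inE negb_or andbC.
Qed.

Lemma fo_close_sentence theta : fo_sentence (fo_close theta).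
Proof.
rewrite /fo_sentence fo_fv_foldr -(filter_pred0 (fo_fv theta)).
by apply: eq_in_filter => x -> .
Qed.

Lemma eta_with_id (T : Type) (e : nat -> T) x : ([eta e with x |-> e x] : nat -> T) = e.
Proof. by apply/funext => y /=; case: eqP => [->|]. Qed.

Lemma fo_sat_close (G : groupType) theta :
  (forall e : nat -> G, fo_sat e (fo_close theta)) <-> (forall e : nat -> G, fo_sat e theta).
Proof.
rewrite /fo_close; elim: (fo_fv theta) => //= x r <-; split=> h e; last by move=> a.
by have := h e (e x); rewrite eta_with_id.
Qed.

(** With a translation closed off in this way, its free variables need not be tracked. *)
Lemma fo_theory_close (G : groupType) theta :
  fo_theory G (fo_close theta) <-> forall e : nat -> G, fo_sat e theta.
Proof.
rewrite -fo_sat_close; split=> [[]//|h].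
by split=> //; exact: fo_close_sentence.
Qed.

Lemma fo_sat_foldr_all (G : groupType) (e : nat -> G) theta r :
  fo_sat e (foldr FOAll theta r) <->
  forall e' : nat -> G, (forall x, x \notin r -> e' x = e x) -> fo_sat e' theta.
Proof.
elim: r e => [|y r IHr] e /=.
  split=> [h e' ee'|]; last exact.
  by have -> : e' = e by apply/funext => x; rewrite ee'.
split=> [h e' ee'|h a].
  apply: ((IHr _).1 (h (e' y))) => x xr /=; case: eqP => [->//|/eqP xy].
  by rewrite ee' // inE negb_or xy.
apply/IHr => e' ee'; apply: h => x; rewrite inE negb_or => /andP[/negPf xy xr].
by rewrite ee' //= xy.
Qed.

(** * Translation of second-order formulas into the language of groups *)

Definition GConj p u := GMul (GMul p u) (GInv p).
Definition GCmt p s := GMul (GMul (GMul p s) (GInv p)) (GInv s).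
Definition FOCommute t u := FOEq (GMul t u) (GMul u t).

Definition fo_inner x :=
  let c k := GCmt (GVar x) (GVar k) in
  FOAll 1%N (FOAll 2 (FOAll 3 (FOImp (FONot (FOEq (c 2) GOne))
    (FOImp (FOCommute (c 1%N) (c 2)) (FOImp (FOCommute (c 2) (c 3))
       (FOCommute (c 1%N) (c 3))))))).

(** The variables 1, 2, 3 are bound in [fo_inner], so x has to avoid capture by them. *)
Lemma fo_sat_inner (G : groupType) (e : nat -> G) x : x = 0 \/ 3 < x ->
  fo_sat e (fo_inner x) <-> inner_like (e x).
Proof. by case: x => [|[|[|[|x]]]] []. Qed.

Definition varcode := (nat + relvar * nat)%type.

Fact varcode_nat : exists f : varcode -> nat, injective f.
Proof. by exists pickle; exact: pcan_inj pickleK. Qed.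

(* Variables 0..3 are scratch variables.  The encoding is opaque, so that conversion
   never tries to compute it. *)
Definition vcode (p : varcode) : nat := (sval (cid varcode_nat) p).+4.
Definition evar (x : nat) : nat := vcode (inl x).
Definition rvar (X : relvar) (k : nat) : nat := vcode (inr (X, k)).

Lemma vcode_inj : injective vcode.
Proof. by move=> p q [] /(svalP (cid varcode_nat)). Qed.

Lemma evar_fresh x : evar x = 0 \/ 3 < evar x.
Proof. by right. Qed.

(** This is [codes] written inside Aut(F): variable 0 stands for [inn u], and applying an
    automorphism to u becomes conjugation. The codes 0, 1, 2 of X hold alpha, s, omega, and [k.+3]
    holds [sig k]. *)
Definition fo_rel (X : relvar) (xs : X.1.-tuple nat) :=
  let v k := GVar (rvar X k) in
  FOEx 0 (FOAnd (fo_inner 0) (FOAnd (FONot (FOEq (GVar 0) GOne))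
    (FOAnd (FOEq (GConj (v 0) (GVar 0)) (GVar 0))
    (FOAnd (FOEq (GConj (v 2) (GConj (v 1%N) (GVar 0))) (GMul (GConj (v 1%N) (GVar 0)) (GVar 0)))
      (fo_big_and (fun k : 'I_X.1 =>
         FOEq (GConj (v k.+3) (GVar 0)) (GMul (GVar 0) (GVar (evar (tnth xs k)))))
         (enum 'I_X.1)))))).

Fixpoint so_to_fo (chi : so_formula) : fo_formula :=
  match chi with
  | SOEq x y => FOEq (GVar (evar x)) (GVar (evar y))
  | SORel X xs => @fo_rel X xs
  | SOFalse => FOFalse
  | SOImp chi1 chi2 => FOImp (so_to_fo chi1) (so_to_fo chi2)
  | SOAll x chi1 => FOAll (evar x) (FOImp (fo_inner (evar x)) (so_to_fo chi1))
  | SOAllRel X chi1 => foldr FOAll (so_to_fo chi1) [seq rvar X k | k <- iota 0 X.1.+3]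
  end.

Definition decode (F : groupType) (e : nat -> aut F) (X : relvar) : set (X.1.-tuple F) :=
  [set t | codes (e (rvar X 0)) (e (rvar X 1%N)) (e (rvar X 2))
             (fun k : 'I_X.1 => e (rvar X k.+3)) t].

Arguments decode {F} e X.

Lemma decode_ext (F : groupType) (e e' : nat -> aut F) X :
  (forall k, e (rvar X k) = e' (rvar X k)) -> decode e X = decode e' X.
Proof.
move=> ee'; rewrite /decode !ee'.
have -> : (fun k : 'I_X.1 => e (rvar X k.+3)) = (fun k : 'I_X.1 => e' (rvar X k.+3)).
  by apply/funext => k.
by [].
Qed.

Section Interpretation.
Variables (I : choiceType) (F : groupType) (i0 : I -> F).
Hypothesis Ffree : free_on i0.
Hypothesis I_inf : forall s : seq I, exists i, i \notin s.
Hypothesis I_idx : forall n, injects ((n.-tuple F * nat) * bool) I.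

Lemma fo_sat_rel (e : nat -> aut F) (v : nat -> F) X (xs : X.1.-tuple nat) :
    (forall x, x \in xs -> e (evar x) = inn (v x)) ->
  fo_sat e (fo_rel xs) <-> decode e X (map_tuple v xs).
Proof.
move=> ev; rewrite fo_sat_ex.
have innI := inn_inj Ffree I_inf.
split.
  case=> a; rewrite !fo_sat_and fo_sat_inner; last by left.
  rewrite /= => -[/(inner_likeP Ffree I_inf)[u ->]].
  rewrite !innJ -!innM => -[u1 [/innI au [/innI ou /fo_sat_big_and st]]].
  exists u; split; first by split=> [u0|//]; apply: u1; rewrite u0 inn1.
  move=> k; have /= := st k; rewrite mem_enum => /(_ isT).
  rewrite innJ ev ?mem_tnth // -innM => /innI ->.
  by rewrite tnth_map.
case=> u [[u1 [au ou]] st]; exists (inn u); rewrite !fo_sat_and fo_sat_inner; last by left.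
split; first by apply/(inner_likeP Ffree I_inf); exists u.
rewrite /= !innJ -!innM au ou; split.
  by move=> /(inn_eq1 Ffree I_inf).
do 2! split=> //; apply/fo_sat_big_and => k _ /=.
by rewrite innJ st tnth_map innM ev ?mem_tnth.
Qed.

Lemma so_to_foP chi (e : nat -> aut F) (v : nat -> F) (s : relassign F) :
    (forall x, x \in so_fv chi -> e (evar x) = inn (v x)) ->
    (forall X, X \in so_fvrel chi -> decode e X = s X) ->
  fo_sat e (so_to_fo chi) <-> so_sat v s chi.
Proof.
have innI := inn_inj Ffree I_inf.
elim: chi e v s => [x y|X xs||chi1 IH1 chi2 IH2|x chi IH|X chi IH] e v s ve se.
- by rewrite /= !ve ?inE ?eqxx ?orbT //; split=> [/innI|->].
- rewrite /= -(se X) ?inE ?eqxx //; apply: fo_sat_rel; exact: ve.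
- by [].
- have h1 : fo_sat e (so_to_fo chi1) <-> so_sat v s chi1.
    by apply: IH1 => [x h|X h]; [apply: ve|apply: se]; rewrite /= mem_cat h.
  have h2 : fo_sat e (so_to_fo chi2) <-> so_sat v s chi2.
    by apply: IH2 => [x h|X h]; [apply: ve|apply: se]; rewrite /= mem_cat h orbT.
  by rewrite /= h1 h2.
- have key g : fo_sat [eta e with evar x |-> inn g] (so_to_fo chi) <->
      so_sat [eta v with x |-> g] s chi.
    apply: IH => [y yc|X Xc] /=.
      have [->|yx] := eqVneq y x; first by rewrite eqxx.
      have -> : (evar y == evar x) = false.
        by apply: contraNF yx => /eqP/vcode_inj[->].
      by apply: ve; rewrite mem_filter yx.
    rewrite -se //; apply: decode_ext => k /=.
    by case: eqP => // /vcode_inj.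
  split=> [h g|h a].
    apply/key; apply: h; apply/(fo_sat_inner _ (evar_fresh x)); rewrite [X in inner_like X]/= eqxx.
    by apply/(inner_likeP Ffree I_inf); exists g.
  move=> /(fo_sat_inner _ (evar_fresh x)); rewrite [X in inner_like X]/= eqxx.
  by move=> /(inner_likeP Ffree I_inf)[g ->]; apply/key.
rewrite fo_sat_foldr_all.
have key e' : (forall x, x \notin [seq rvar X k | k <- iota 0 X.1.+3] -> e' x = e x) ->
    fo_sat e' (so_to_fo chi) <-> so_sat v (dfwith s (decode e' X)) chi.
  move=> ee'; have old p : (forall k, p <> inr (X, k)) -> e' (vcode p) = e (vcode p).
    by move=> pX; apply: ee'; apply/mapP => -[k _] /vcode_inj; exact: pX.
  apply: IH => [x xc|Z Zc]; first by rewrite -ve // /evar old.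
  have [->|ZX] := eqVneq Z X; first by rewrite dfwith_in.
  rewrite dfwith_out 1?eq_sym // -se ?mem_filter ?ZX //.
  apply: decode_ext => k; apply: old => k' [/eqP]; by rewrite (negPf ZX).
(* Any choice of automorphisms decodes to some relation. Conversely every relation A is reached,
   being codable. *)
split=> [h A|h e' ee']; last exact/key.
have [al [sg [om [sig sigE]]]] := relation_codable Ffree A (I_idx _).
pose val (k : nat) : aut F := match k with 0 => al | 1 => sg | 2 => om
  | k.+3 => if insub k is Some i then sig i else 1 end.
pose e' x := if pselect (exists2 k, k < X.1.+3 & x = rvar X k) is left h
  then val (s2val (cid2 h)) else e x.
have e'r k : k < X.1.+3 -> e' (rvar X k) = val k.
  move=> kX; rewrite /e'; case: pselect => [h'|[]]; last by exists k.
  by case: cid2 => k' /= _ /vcode_inj[->].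
have <- : decode e' X = A.
  apply/seteqP; suff h' t : decode e' X t <-> A t by split=> t /h'.
  rewrite -sigE /decode /= !e'r //=; suff -> : (fun k : 'I_X.1 => e' (rvar X k.+3)) = sig by [].
  by apply/funext => k; rewrite e'r ?ltnS //= valK.
apply/key => [x|]; last apply: h => x.
all: move=> nx; rewrite /e'; case: pselect => // -[k kX ex]; case/negP: nx.
all: by rewrite ex map_f // mem_iota.
Qed.
End Interpretation.

(** Pure second-order logic sees only the cardinal; this moves truth between K and F. *)
Lemma so_sat_bij (T U : Type) (f : T -> U) (g : U -> T) chi (v : nat -> T) (s : relassign T)
    (s' : relassign U) :
    cancel f g -> cancel g f ->
    (forall X t, s X t <-> s' X (map_tuple f t)) ->
  so_sat v s chi <-> so_sat (f \o v) s' chi.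
Proof.
move=> fK gK; elim: chi v s s' => [x y|X xs||chi1 IH1 chi2 IH2|x chi IH|X chi IH] v s s' ss' /=.
- by split=> [->//|/(can_inj fK)].
- rewrite ss'; suff -> : map_tuple f (map_tuple v xs) = map_tuple (f \o v) xs by [].
  by apply: val_inj; rewrite /= -map_comp.
- by [].
- by rewrite (IH1 _ _ _ ss') (IH2 _ _ _ ss').
- have key a : so_sat [eta v with x |-> a] s chi <->
      so_sat [eta f \o v with x |-> f a] s' chi.
    rewrite (IH _ _ _ ss'); suff -> : f \o [eta v with x |-> a] =
       ([eta f \o v with x |-> f a] : nat -> U) by [].
    by apply/funext => y /=; case: eqP.
  split=> h a; last by apply/key.
  by rewrite -(gK a); apply/key.
- have key (A : set (X.1.-tuple T)) (A' : set (X.1.-tuple U)) : (forall t, A t <-> A' (map_tuple f t)) ->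
      so_sat v (dfwith s A) chi <-> so_sat (f \o v) (dfwith s' A') chi.
    move=> AA'; apply: IH => Z t; have [e|ZX] := eqVneq X Z.
      by subst Z; rewrite !dfwith_in.
    by rewrite !dfwith_out.
  have fgt n (t : n.-tuple U) : map_tuple f (map_tuple g t) = t.
    by apply: val_inj; rewrite /= -map_comp -[RHS]map_id; apply: eq_map.
  have gft n (t : n.-tuple T) : map_tuple g (map_tuple f t) = t.
    by apply: val_inj; rewrite /= -map_comp -[RHS]map_id; apply: eq_map.
  split=> h A.
    by apply/(key [set t | A (map_tuple f t)]).
  by apply/(key A [set t | A (map_tuple g t)]) => // t /=; rewrite gft.
Qed.

(** Normal forms embed F into the lists of signed basis elements, and lists over an infinite set do
    not raise its cardinal. So F is as large as K, and the basis has room for the indices of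
    [relation_codable]. *)
Lemma free_of_rank_data (K : Type) (F : groupType) :
    infinite_set [set: K] -> free_of_rank F K ->
  exists (I : choiceType) (i0 : I -> F),
    [/\ free_on i0, forall s : seq I, exists i, i \notin s,
        forall n, injects ((n.-tuple F * nat) * bool) I
      & exists h : K -> F, bijective h].
Proof.
move=> Kinf [B FB]; rewrite card_eq_le => /andP[/card_le_inj BK /card_le_inj KB].
have {}BK : injects B K := injects_trans BK (injects_setT K).2.
have {}KB : injects K B := injects_trans (injects_setT K).1 KB.
have Ffree := free_basis_on FB.
have FK : injects F K.
  apply: (@injects_trans _ (seq (B * bool))); last first.
    apply: (injects_seq Kinf); apply: (injects_prod Kinf BK); exact: injects_count.
  by exists (nf Ffree); exact: nf_inj.
exists B, (fun x : B => val x); split => //.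
- exact: (infinite_fresh Kinf KB).
- move=> n; apply: injects_trans KB.
  apply: (injects_prod Kinf); last exact: injects_count.
  apply: (injects_prod Kinf); last exact: injects_count.
  exact: injects_tuple.
- have [f fI] := FK; have [g gI] : injects K F.
    by apply: injects_trans KB _; exists val; exact: val_inj.
  exact: inj_inj_bij gI fI.
Qed.

Lemma so_theory_interpretable chi : so_sentence chi ->
  exists chi' : fo_formula, fo_sentence chi' /\
    forall (K : Type) (F : groupType),
      infinite_set [set: K] -> free_of_rank F K ->
      (so_theory K chi <-> fo_theory (aut F) chi').
Proof.
move=> chiS; exists (fo_close (so_to_fo chi)); split; first exact: fo_close_sentence.
move=> K F Kinf FK.
have [I [i0 [Ffree I_inf I_idx [h [g hK gK]]]]] := free_of_rank_data Kinf FK.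
rewrite fo_theory_close; case: (chiS) => fv0 fvrel0.
have equiv (e : nat -> aut F) (v : nat -> K) (s : relassign K) :
    fo_sat e (so_to_fo chi) <-> so_sat v s chi.
  have ggh n (t : n.-tuple K) : map_tuple g (map_tuple h t) = t.
    by apply: val_inj; rewrite /= -map_comp -[RHS]map_id; apply: eq_map.
  rewrite (so_sat_bij (s' := fun X t => s X (map_tuple g t)) _ _ hK gK).
    by apply: (so_to_foP Ffree I_inf I_idx); rewrite ?fv0 ?fvrel0.
  by move=> X t; rewrite ggh.
split=> [[_ hs] e|hs]; last by split=> // v s; apply/(equiv (fun=> 1)).
by apply/(equiv e (fun=> g 1) (fun _ => set0)).
Qed.

(** * From group sentences to second-order sentences *)

Definition group_op (K : Type) (mul : K -> K -> K) :=
  associative mul /\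
  exists e, forall a, [/\ mul e a = a, mul a e = a & exists b, mul a b = e /\ mul b a = e].

Section OpGroup.
Variables (K : Type) (mul : K -> K -> K).
Hypothesis mulP : group_op mul.

(** An alias of K whose type mentions the operation, so that different group operations on the same
    K can carry different canonical structures. *)
Definition op_carrier of group_op mul := K.
Local Notation C := (op_carrier mulP).
HB.instance Definition _ := gen_eqMixin C.
HB.instance Definition _ := gen_choiceMixin C.

Let one_ex := cid mulP.2.
Let one : C := sval one_ex.
Let oneP := svalP one_ex.
Let inv_ex a : {b | mul a b = one /\ mul b a = one}.
Proof. by apply: cid; have [_ _] := oneP a. Qed.
Let inv (a : C) : C := sval (inv_ex a).

Fact op_mulA : @associative C mul. Proof. exact: mulP.1. Qed.
Fact op_mul1 : @left_id C C one mul. Proof. by move=> a; have [] := oneP a. Qed.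
Fact op_1mul : @right_id C C one mul. Proof. by move=> a; have [] := oneP a. Qed.
Fact op_mulV : @left_inverse C C C one inv mul.
Proof. by move=> a; have [] := svalP (inv_ex a). Qed.
Fact op_mulVr : @right_inverse C C C one inv mul.
Proof. by move=> a; have [] := svalP (inv_ex a). Qed.
HB.instance Definition _ := isGroup.Build C op_mulA op_mul1 op_1mul op_mulV op_mulVr.

Definition op_group : groupType := C.
Lemma op_groupM (x y : op_group) : x * y = mul x y. Proof. by []. Qed.
End OpGroup.

Definition op_morph (K : Type) (m m' : K -> K -> K) (g : K -> K) :=
  forall x y, g (m x y) = m' (g x) (g y).

(* Freeness tested only against groups with the same carrier, which is enough because
   a free group of rank K has cardinal K. *)
Definition op_free_basis (K : Type) (m : K -> K -> K) (b : K -> K) :=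
  forall m', group_op m' ->
    (forall f : K -> K, exists g, op_morph m m' g /\ forall k, g (b k) = f k) /\
    (forall g g', op_morph m m' g -> op_morph m m' g' ->
       (forall k, g (b k) = g' (b k)) -> forall x, g x = g' x).

Section OpFree.
Variables (K : Type) (F : groupType) (j : K -> F) (h : K -> F) (h' : F -> K).
Hypothesis Ffree : free_on j.
Hypotheses (hK : cancel h h') (h'K : cancel h' h).

Definition op_transport (a b : K) : K := h' (h a * h b).

Lemma op_transport_group : group_op op_transport.
Proof.
rewrite /op_transport; split=> [a b c|]; first by rewrite !h'K mulgA.
exists (h' 1) => a; rewrite h'K mul1g mulg1 hK; split=> //.
by exists (h' (h a)^-1); rewrite !h'K mulgV mulVg.
Qed.

Lemma op_transport_free : op_free_basis op_transport (h' \o j).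
Proof.
move=> m' m'P; split=> [f|g g' gM g'M gg' x].
  have [g gM gj] := Ffree.1 (op_group m'P) f.
  exists (g \o h); split=> [x y|k] /=; first by rewrite h'K gM.
  by rewrite h'K.
have : (g \o h' : F -> op_group m'P) =1 g' \o h'.
  apply: Ffree.2 => [a b|a b|//] /=; rewrite op_groupM -?gM -?g'M.
    by rewrite /op_transport !h'K.
  by rewrite /op_transport !h'K.
by move/(_ (h x)); rewrite /= hK.
Qed.

(** Up to h both groups live on K, so each is an admissible test group for the other. The morphisms
    extending the matching of bases are mutually inverse by uniqueness. *)
Lemma op_free_iso (m : K -> K -> K) b : group_op m -> op_free_basis m b ->
  exists2 k : K -> F, bijective k & forall x y, k (m x y) = k x * k y.
Proof.
move=> mP mb; have [ex _] := mb _ op_transport_group.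
have [g [gM gb]] := ex (h' \o j).
have [g' g'M g'j] := Ffree.1 (op_group mP) b.
have kM x y : h (g (m x y)) = h (g x) * h (g y) by rewrite gM h'K.
exists (h \o g) => //; exists g' => x.
  have [_ uniq] := mb _ mP.
  apply: (uniq (g' \o (h \o g)) id) => //= [y z|k]; first by rewrite /= kM g'M.
  by rewrite gb /= h'K g'j.
apply: (Ffree.2 _ (h \o g \o g') id) => //= [y z|k]; last by rewrite g'j gb /= h'K.
by rewrite /= g'M kM.
Qed.

End OpFree.

(** * Second-order formulas for maps, operations and free groups *)

Definition SONot a := SOImp a SOFalse.
Definition SOAnd a b := SONot (SOImp a (SONot b)).
Definition SOEx x a := SONot (SOAll x (SONot a)).

Lemma so_sat_and (K : Type) (e : nat -> K) (s : relassign K) a b :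
  so_sat e s (SOAnd a b) <-> so_sat e s a /\ so_sat e s b.
Proof.
split=> /= [h|[ha hb]]; last exact.
by split; apply: contrapT => n; apply: h.
Qed.

Lemma so_sat_ex (K : Type) (e : nat -> K) (s : relassign K) x a :
  so_sat e s (SOEx x a) <-> exists u, so_sat [eta e with x |-> u] s a.
Proof.
split=> /= [h|[u hu]]; last by move=> /(_ u).
by apply: contrapT => n; apply: h => u hu; apply: n; exists u.
Qed.

Section SatCongruence.
Variables (K : Type) (e : nat -> K) (s : relassign K).

Lemma sat_all x a (P : K -> Prop) : (forall u, so_sat [eta e with x |-> u] s a <-> P u) ->
  so_sat e s (SOAll x a) <-> forall u, P u.
Proof. by move=> aP; split=> h u; apply/aP; exact: h. Qed.

Lemma sat_ex x a (P : K -> Prop) : (forall u, so_sat [eta e with x |-> u] s a <-> P u) ->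
  so_sat e s (SOEx x a) <-> exists u, P u.
Proof. by move=> aP; rewrite so_sat_ex; split=> -[u /aP hu]; exists u. Qed.

Lemma sat_and a b (P Q : Prop) : (so_sat e s a <-> P) -> (so_sat e s b <-> Q) ->
  so_sat e s (SOAnd a b) <-> P /\ Q.
Proof. by rewrite so_sat_and => -> ->. Qed.

Lemma sat_imp a b (P Q : Prop) : (so_sat e s a <-> P) -> (so_sat e s b <-> Q) ->
  so_sat e s (SOImp a b) <-> (P -> Q).
Proof. by move=> aP bQ; rewrite /= aP bQ. Qed.
End SatCongruence.

Definition R2 k a b := SORel (2, k) [tuple a; b].
Definition R3 k a b c := SORel (3, k) [tuple a; b; c].

Section Graphs.
Variable K : Type.
Implicit Types (e : nat -> K) (s : relassign K) (f g : K -> K) (m : K -> K -> K).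

(** Only relation variables are available, so maps and operations on K enter through their graphs,
    held by [(2, k)] and [(3, k)] respectively. *)
Definition gr2 f : set (2.-tuple K) := 
  [set t | if val t is [:: a; b] then f a = b else False].
Definition gr3 m : set (3.-tuple K) := 
  [set t | if val t is [:: a; b; c] then m a b = c else False].
Definition has2 s k f := s (2, k) = gr2 f.
Definition has3 s k m := s (3, k) = gr3 m.

Lemma so_sat_R2 e s k f a b : has2 s k f -> so_sat e s (R2 k a b) <-> f (e a) = e b.
Proof. by rewrite /has2 /= => ->. Qed.

Lemma so_sat_R3 e s k m a b c : has3 s k m -> so_sat e s (R3 k a b c) <-> m (e a) (e b) = e c.
Proof. by rewrite /has3 /= => ->. Qed.

Lemma has2_in s k f : has2 (dfwith s (gr2 f : set ((2, k).1.-tuple K))) k f.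
Proof. exact: (dfwith_in s (i := (2, k))). Qed.

Lemma has2_out s k f X (A : set (X.1.-tuple K)) : X != (2, k) -> has2 s k f ->
  has2 (dfwith s A) k f.
Proof. by move=> Xk; rewrite /has2 dfwith_out. Qed.

Lemma has3_in s k m : has3 (dfwith s (gr3 m : set ((3, k).1.-tuple K))) k m.
Proof. exact: (dfwith_in s (i := (3, k))). Qed.

Lemma has3_out s k m X (A : set (X.1.-tuple K)) : X != (3, k) -> has3 s k m ->
  has3 (dfwith s A) k m.
Proof. by move=> Xk; rewrite /has3 dfwith_out. Qed.

Lemma tuple2P (t : 2.-tuple K) : exists a b, t = [tuple a; b].
Proof.
case: t => -[|a [|b [|? ?]]] // tP; exists a, b; exact: val_inj.
Qed.

Lemma tuple3P (t : 3.-tuple K) : exists a b c, t = [tuple a; b; c].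
Proof.
case: t => -[|a [|b [|c [|? ?]]]] // tP; exists a, b, c; exact: val_inj.
Qed.

Lemma gr2P (A : set (2.-tuple K)) f :
  (forall a b, A [tuple a; b] <-> f a = b) -> A = gr2 f.
Proof. by move=> Af; apply/seteqP; split=> t; have [a [b ->]] := tuple2P t => /Af. Qed.

Lemma gr3P (A : set (3.-tuple K)) m :
  (forall a b c, A [tuple a; b; c] <-> m a b = c) -> A = gr3 m.
Proof. by move=> Af; apply/seteqP; split=> t; have [a [b [c ->]]] := tuple3P t => /Af. Qed.

Lemma so_sat_R2E e s k a b : so_sat e s (R2 k a b) <-> s (2, k) [tuple e a; e b].
Proof. by rewrite /=; suff -> : map_tuple e [tuple a; b] = [tuple e a; e b] by []; exact: val_inj. Qed.

Lemma so_sat_R3E e s k a b c : so_sat e s (R3 k a b c) <-> s (3, k) [tuple e a; e b; e c].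
Proof.
by rewrite /=; suff -> : map_tuple e [tuple a; b; c] = [tuple e a; e b; e c] by []; exact: val_inj.
Qed.

End Graphs.

Definition so_fun k := SOAll 0 (SOEx 1 (SOAnd (R2 k 0 1)
  (SOAll 2 (SOImp (R2 k 0 2) (SOEq 1 2))))).

Definition so_assoc k := SOAll 0 (SOAll 1 (SOAll 2 (SOAll 3 (SOAll 4 (SOAll 5
  (SOImp (R3 k 0 1 3) (SOImp (R3 k 1 2 4) (SOImp (R3 k 3 2 5) (R3 k 0 4 5))))))))).

Definition so_unit k := SOEx 0 (SOAll 1 (SOAnd (R3 k 0 1 1) (SOAnd (R3 k 1 0 1)
  (SOEx 2 (SOAnd (R3 k 1 2 0) (R3 k 2 1 0)))))).

Definition so_op k := SOAll 0 (SOAll 1 (SOEx 2 (SOAnd (R3 k 0 1 2)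
  (SOAll 3 (SOImp (R3 k 0 1 3) (SOEq 2 3)))))).

Definition so_grp k := SOAnd (so_op k) (SOAnd (so_assoc k) (so_unit k)).

Definition so_hom g k k' := SOAll 0 (SOAll 1 (SOAll 2 (SOAll 3 (SOAll 4 (SOAll 5
  (SOImp (R3 k 0 1 2) (SOImp (R2 g 0 3) (SOImp (R2 g 1 4) (SOImp (R2 g 2 5)
    (R3 k' 3 4 5)))))))))).

Definition so_bij k := SOAnd
  (SOAll 0 (SOAll 1 (SOAll 2 (SOImp (R2 k 0 2) (SOImp (R2 k 1 2) (SOEq 0 1))))))
  (SOAll 1 (SOEx 0 (R2 k 0 1))).

Definition SOAllFun k a := SOAllRel (2, k) (SOImp (so_fun k) a).
Definition SOExFun k a := SONot (SOAllFun k (SONot a)).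
Definition SOAllGrp k a := SOAllRel (3, k) (SOImp (so_grp k) a).

Section GraphFormulas.
Variable K : Type.
Implicit Types (e : nat -> K) (s : relassign K) (f g : K -> K) (m : K -> K -> K).

Lemma so_sat_fun e s k : so_sat e s (so_fun k) <-> exists f, has2 s k f.
Proof.
transitivity (forall a, exists b, s (2, k) [tuple a; b] /\
    forall c, s (2, k) [tuple a; c] -> b = c).
  apply: sat_all => a; apply: sat_ex => b; apply: sat_and; first exact: so_sat_R2E.
  by apply: sat_all => c; apply: sat_imp; first exact: so_sat_R2E.
split=> [/choice[f fP]|[f ->] a]; last by exists (f a); split.
exists f; apply: gr2P => a b.
by have [f1 f2] := fP a; split=> [/f2|<-].
Qed.

Lemma so_sat_op e s k : so_sat e s (so_op k) <-> exists m, has3 s k m.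
Proof.
transitivity (forall a b, exists c, s (3, k) [tuple a; b; c] /\
    forall d, s (3, k) [tuple a; b; d] -> c = d).
  apply: sat_all => a; apply: sat_all => b; apply: sat_ex => c.
  apply: sat_and; first exact: so_sat_R3E.
  by apply: sat_all => d; apply: sat_imp; first exact: so_sat_R3E.
split=> [h|[m ->] a b]; last by exists (m a b); split.
have [f fP] := choice (fun p : K * K => h p.1 p.2).
exists (fun a b => f (a, b)); apply: gr3P => a b c.
by have [f1 f2] := fP (a, b); split=> [/f2|<-].
Qed.

Lemma so_sat_assoc e s k m : has3 s k m -> so_sat e s (so_assoc k) <-> associative m.
Proof.
move=> sm; transitivity (forall a b c ab bc x,
    m a b = ab -> m b c = bc -> m ab c = x -> m a bc = x).
  do 6! (apply: sat_all => ?); do 3! (apply: sat_imp; first exact: so_sat_R3 sm).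
  exact: so_sat_R3 sm.
split=> [h a b c|mA a b c ab bc x <- <- <-]; last exact: mA.
exact: h.
Qed.

Lemma so_sat_unit e s k m : has3 s k m -> so_sat e s (so_unit k) <->
  exists o, forall a, [/\ m o a = a, m a o = a & exists b, m a b = o /\ m b a = o].
Proof.
move=> sm; transitivity (exists o, forall a, m o a = a /\ (m a o = a /\
    exists b, m a b = o /\ m b a = o)).
  apply: sat_ex => u; apply: sat_all => a; apply: sat_and; first exact: so_sat_R3 sm.
  apply: sat_and; first exact: so_sat_R3 sm.
  by apply: sat_ex => b; apply: sat_and; exact: so_sat_R3 sm.
by split=> -[u h]; exists u => a; have := h a; [case=> ? []|case].
Qed.

Lemma so_sat_grp e s k : so_sat e s (so_grp k) <-> exists2 m, group_op m & has3 s k m.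
Proof.
rewrite !so_sat_and so_sat_op; split.
  case=> -[m sm]; rewrite (so_sat_assoc _ sm) (so_sat_unit _ sm) => mP.
  by exists m.
case=> m mP sm; rewrite (so_sat_assoc _ sm) (so_sat_unit _ sm).
by split; first by exists m.
Qed.

Lemma so_sat_hom e s n k k' G m m' : has2 s n G -> has3 s k m -> has3 s k' m' ->
  so_sat e s (so_hom n k k') <-> op_morph m m' G.
Proof.
move=> sg sm sm'; transitivity (forall a b c a' b' c', m a b = c -> G a = a' ->
    G b = b' -> G c = c' -> m' a' b' = c').
  do 6! (apply: sat_all => ?); apply: sat_imp; first exact: so_sat_R3 sm.
  do 3! (apply: sat_imp; first exact: so_sat_R2 sg).
  exact: so_sat_R3 sm'.
split=> [h a b|mG a b c a' b' c' <- <- <- <-]; last by rewrite mG.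
by apply/esym; exact: h.
Qed.

Lemma so_sat_bijective e s k f : has2 s k f -> so_sat e s (so_bij k) <-> bijective f.
Proof.
move=> sf; transitivity ((forall a b c, f a = c -> f b = c -> a = b) /\
    forall b, exists a, f a = b).
  apply: sat_and.
    do 3! (apply: sat_all => ?).
    by do 2! (apply: sat_imp; first exact: so_sat_R2 sf).
  by apply: sat_all => b; apply: sat_ex => a; exact: so_sat_R2 sf.
split=> [[fI /choice[g fK]]|[g fK gK]].
  by exists g => // a; apply: (fI _ _ (f a)).
by split=> [a b c <- /(can_inj fK)|b]; [|exists (g b)].
Qed.

Lemma sat_all_fun e s k a (P : (K -> K) -> Prop) :
    (forall f, so_sat e (dfwith s (gr2 f : set ((2, k).1.-tuple K))) a <-> P f) ->
  so_sat e s (SOAllFun k a) <-> forall f, P f.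
Proof.
move=> aP; split=> [h f|h A hA].
  by apply/aP/h; apply/so_sat_fun; exists f; exact: has2_in.
have [f] := (so_sat_fun _ _ _).1 hA; rewrite /has2 dfwith_in => ->.
exact/aP.
Qed.

Lemma sat_ex_fun e s k a (P : (K -> K) -> Prop) :
    (forall f, so_sat e (dfwith s (gr2 f : set ((2, k).1.-tuple K))) a <-> P f) ->
  so_sat e s (SOExFun k a) <-> exists f, P f.
Proof.
move=> aP; have aP' f : so_sat e (dfwith s (gr2 f : set ((2, k).1.-tuple K))) (SONot a)
    <-> ~ P f.
  by rewrite /= aP.
transitivity (~ forall f, ~ P f); first by rewrite -(sat_all_fun aP').
split=> [h|[f Pf] /(_ f)//].
by apply: contrapT => n; apply: h => f Pf; apply: n; exists f.
Qed.

Lemma sat_all_grp e s k a (P : (K -> K -> K) -> Prop) :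
    (forall m, group_op m ->
       so_sat e (dfwith s (gr3 m : set ((3, k).1.-tuple K))) a <-> P m) ->
  so_sat e s (SOAllGrp k a) <-> forall m, group_op m -> P m.
Proof.
move=> aP; split=> [h m mP|h A hA].
  by apply/(aP m mP)/h; apply/so_sat_grp; exists m => //; exact: has3_in.
have [m mP] := (so_sat_grp _ _ _).1 hA; rewrite /has3 dfwith_in => ->.
by apply/aP => //; exact: h.
Qed.

End GraphFormulas.

(** The operation is [(3, 0)], the test group [(3, 1)], the basis map [(2, 0)]. In the existence
    clause [(2, 1)] is the prescribed map and [(2, 2)] its extension; in the uniqueness clause
    [(2, 2)] and [(2, 3)] are the two morphisms. *)
Definition so_free :=
  SOExFun 0 (SOAllGrp 1 (SOAnd
    (SOAllFun 1 (SOExFun 2 (SOAnd (so_hom 2 0 1)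
       (SOAll 0 (SOAll 1 (SOAll 2 (SOImp (R2 0 0 1) (SOImp (R2 1 0 2) (R2 2 1 2)))))))))
    (SOAllFun 2 (SOAllFun 3 (SOImp (so_hom 2 0 1) (SOImp (so_hom 3 0 1) (SOImp
       (SOAll 0 (SOAll 1 (SOAll 2 (SOImp (R2 0 0 1) (SOImp (R2 2 1 2) (R2 3 1 2))))))
       (SOAll 0 (SOAll 1 (SOImp (R2 2 0 1) (R2 3 0 1))))))))))).

(** Terms denote automorphisms and are described by their graphs: t takes the point a to b. Element
    variables from n on are fresh. In a product the right factor acts first. *)
Fixpoint so_term (t : grp_term) (a b n : nat) : so_formula :=
  match t with
  | GVar x => R2 x a b
  | GOne => SOEq a b
  | GMul t1 t2 => SOEx n (SOAnd (so_term t2 a n n.+1) (so_term t1 n b n.+1))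
  | GInv t1 => so_term t1 b a n
  end.

(** Variable x becomes [(2, x)], the graph of an automorphism for the operation [(3, 0)]. For an
    equation it is enough to include one graph in the other, both being graphs of total maps. *)
Fixpoint fo_to_so (theta : fo_formula) : so_formula :=
  match theta with
  | FOEq t1 t2 => SOAll 0 (SOAll 1 (SOImp (so_term t1 0 1 2) (so_term t2 0 1 2)))
  | FOFalse => SOFalse
  | FOImp theta1 theta2 => SOImp (fo_to_so theta1) (fo_to_so theta2)
  | FOAll x theta1 =>
      SOAllFun x (SOImp (so_bij x) (SOImp (so_hom x 0 0) (fo_to_so theta1)))
  end.

Section FreeFormula.
Variable K : Type.
Implicit Types (e : nat -> K) (s : relassign K) (m : K -> K -> K).

Lemma so_sat_free e s m : has3 s 0 m -> so_sat e s so_free <-> exists b, op_free_basis m b.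
Proof.
move=> sm; apply: sat_ex_fun => b.
have sm0 := has3_out (gr2 b : set ((2, 0).1.-tuple K)) (isT : (2, 0) != (3, 0)) sm.
have sb0 := has2_in s 0 b.
apply: sat_all_grp => m' _.
have sm1 := has3_out (gr3 m' : set ((3, 1%N).1.-tuple K)) (isT : (3, 1%N) != (3, 0)) sm0.
have sb1 := has2_out (gr3 m' : set ((3, 1%N).1.-tuple K)) (isT : (3, 1%N) != (2, 0)) sb0.
have sm'1 := has3_in (dfwith s (gr2 b : set ((2, 0).1.-tuple K))) 1 m'.
have lift2 s' k f : has3 s' 0 m -> has3 s' 1 m' -> has2 s' 0 b -> (2, k.+1) != (2, 0) ->
    let s'' := dfwith s' (gr2 f : set ((2, k.+1).1.-tuple K)) in
    [/\ has3 s'' 0 m, has3 s'' 1 m', has2 s'' 0 b & has2 s'' k.+1 f].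
  by move=> h h' hb k0; split; [exact: has3_out|exact: has3_out|exact: has2_out|exact: has2_in].
apply: sat_and.
  transitivity (forall f, exists g, op_morph m m' g /\ forall k y z, b k = y -> f k = z ->
     g y = z); last first.
    split=> h f; have [g [gM gf]] := h f; exists g; split=> // k; first exact: gf.
    by move=> y z <- <-.
  apply: sat_all_fun => f; have [um um' ub uf] := lift2 _ 0 f sm1 sm'1 sb1 isT.
  apply: sat_ex_fun => g; have [vm vm' vb vg] := lift2 _ 1%N g um um' ub isT.
  have vf := has2_out (gr2 g : set ((2, 2).1.-tuple K)) (isT : (2, 2) != (2, 1%N)) uf.
  apply: sat_and; first exact: so_sat_hom vg vm vm'.
  do 3! (apply: sat_all => ?); apply: sat_imp; first exact: so_sat_R2 vb.
  apply: sat_imp; first exact: so_sat_R2 vf.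
  exact: so_sat_R2 vg.
transitivity (forall g g', op_morph m m' g -> op_morph m m' g' ->
    (forall k y z, b k = y -> g y = z -> g' y = z) -> forall x y, g x = y -> g' x = y).
  apply: sat_all_fun => g; have [um um' ub ug] := lift2 _ 1%N g sm1 sm'1 sb1 isT.
  apply: sat_all_fun => g'; have [vm vm' vb vg'] := lift2 _ 2 g' um um' ub isT.
  have vg := has2_out (gr2 g' : set ((2, 3).1.-tuple K)) (isT : (2, 3) != (2, 2)) ug.
  apply: sat_imp; first exact: so_sat_hom vg vm vm'.
  apply: sat_imp; first exact: so_sat_hom vg' vm vm'.
  apply: sat_imp.
    do 3! (apply: sat_all => ?); apply: sat_imp; first exact: so_sat_R2 vb.
    by apply: sat_imp; [exact: so_sat_R2 vg|exact: so_sat_R2 vg'].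
  by do 2! (apply: sat_all => ?); apply: sat_imp; [exact: so_sat_R2 vg|exact: so_sat_R2 vg'].
split=> h g g' gM g'M gg'.
  by move=> x; apply/esym; apply: (h g g') => // k y z <- <-.
by move=> x y <-; apply/esym; apply: (h g g') => // k; exact/esym/gg'.
Qed.

Variables (F : groupType) (h : K -> F) (h' : F -> K) (m : K -> K -> K).
Hypotheses (hK : cancel h h') (h'K : cancel h' h).
Hypothesis hM : forall x y, h (m x y) = h x * h y.

Let conj (p : aut F) : K -> K := h' \o p \o h.

Lemma so_termP t (e : nat -> aut F) (v : nat -> K) s a b n : a < n -> b < n ->
    (forall x, x \in grp_term_fv t -> has2 s x (conj (e x))) ->
  so_sat v s (so_term t a b n) <-> grp_eval e t (h (v a)) = h (v b).
Proof.
elim: t v a b n => [x||t1 IH1 t2 IH2|t IH] v a b n an bn sx.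
- have sxx := sx x (mem_head _ _).
  transitivity (conj (e x) (v a) = v b); first exact: so_sat_R2 sxx.
  rewrite /conj /=.
  by split=> [<-|->]; rewrite ?h'K ?hK.
- by split=> [/= ->|/(can_inj hK)].
- transitivity (exists c, grp_eval e t2 (h (v a)) = h c /\ grp_eval e t1 (h c) = h (v b)).
    have vn (c : K) k : k < n -> [eta v with n |-> c] k = v k.
      by move=> kn /=; case: eqP kn => // ->; rewrite ltnn.
    have vnn (c : K) : [eta v with n |-> c] n = c by rewrite /= eqxx.
    apply: sat_ex => c; apply: sat_and.
      rewrite -{2}(vnn c) -(vn c a an); apply: IH2; rewrite ?ltnS ?(ltnW an) //.
      by move=> x xt; apply: sx; rewrite /= mem_cat xt orbT.
    rewrite -{2}(vnn c) -(vn c b bn); apply: IH1; rewrite ?ltnS ?(ltnW bn) //.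
    by move=> x xt; apply: sx; rewrite /= mem_cat xt.
  rewrite /=; split=> [[c [-> ->]]//|<-].
  by exists (h' (grp_eval e t2 (h (v a)))); rewrite h'K.
- apply: iff_trans (IH v b a n bn an sx) _.
  by split=> [<-|<-]; rewrite /= ?autVK ?autKV.
Qed.

Lemma fo_to_soP theta (e : nat -> aut F) (v : nat -> K) s :
    has3 s 0 m -> (forall x, x \in fo_fv theta -> has2 s x (conj (e x))) ->
  so_sat v s (fo_to_so theta) <-> fo_sat e theta.
Proof.
elim: theta e v s => [t1 t2||t1 IH1 t2 IH2|x t IH] e v s sm sx.
- transitivity (forall a b, grp_eval e t1 (h a) = h b -> grp_eval e t2 (h a) = h b).
    apply: sat_all => a; apply: sat_all => b; apply: sat_imp.
      by apply: so_termP => // x xt; apply: sx; rewrite /= mem_cat xt.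
    by apply: so_termP => // x xt; apply: sx; rewrite /= mem_cat xt orbT.
  split=> [H|-> //]; apply: aut_eqP => y.
  have := H (h' y) (h' (grp_eval e t1 y)); rewrite !h'K.
  by move=> /(_ erefl).
- by [].
- apply: sat_imp; [apply: IH1|apply: IH2] => // x xt; apply: sx.
    by rewrite /= mem_cat xt.
  by rewrite /= mem_cat xt orbT.
- transitivity (forall f : K -> K, bijective f -> op_morph m m f ->
      so_sat v (dfwith s (gr2 f : set ((2, x).1.-tuple K))) (fo_to_so t)).
    apply: sat_all_fun => f.
    have sf := has2_in s x f.
    have sm0 := has3_out (gr2 f : set ((2, x).1.-tuple K)) (isT : (2, x) != (3, 0)) sm.
    apply: sat_imp; first exact: so_sat_bijective sf.
    by apply: sat_imp; first exact: (so_sat_hom _ sf sm0 sm0).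
  have key (p : aut F) : so_sat v (dfwith s (gr2 (conj p) : set ((2, x).1.-tuple K)))
      (fo_to_so t) <-> fo_sat [eta e with x |-> p] t.
    apply: IH; first exact: has3_out.
    move=> y yt /=; have [->|yx] := eqVneq y x; first exact: has2_in.
    apply: has2_out; first by rewrite xpair_eqE eqxx /= eq_sym.
    by apply: sx; rewrite mem_filter yx.
  have conj_bij p : bijective (conj p).
    by exists (conj p^-1) => y; rewrite /conj /= h'K ?autVK ?autKV hK.
  have h'M a b : h' (a * b) = m (h' a) (h' b) by rewrite -{1}(h'K a) -{1}(h'K b) -hM hK.
  have conj_morph p : op_morph m m (conj p).
    by move=> y z; rewrite /conj /= hM aut_morph h'M.
  split=> [H p|H f [f' fK f'K] fM]; first by apply/key; exact: H.
  (* Every bijective endomorphism f of [m] is [conj p] for p = h f h', so the two quantifiers have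
     the same range. *)
  have [|||p pE] := @aut_ofK F (h \o f \o h') (h \o f' \o h').
  - by move=> a b /=; rewrite h'M fM hM.
  - by move=> a /=; rewrite hK fK h'K.
  - by move=> a /=; rewrite hK f'K h'K.
  have -> : f = conj p by apply/funext => y; rewrite /conj /= pE /= !hK.
  by apply/key.
Qed.
End FreeFormula.

(** * Closed second-order formulas and the second interpretation *)

Definition so_close_elem chi := foldr SOAll chi (so_fv chi).
Definition so_close chi :=
  foldr SOAllRel (so_close_elem chi) (so_fvrel (so_close_elem chi)).

Lemma so_close_sentence chi : so_sentence (so_close chi).
Proof.
rewrite /so_close; set chi1 := so_close_elem chi; split.
  have -> r : so_fv (foldr SOAllRel chi1 r) = so_fv chi1 by elim: r.
  have fvE r : so_fv (foldr SOAll chi r) = [seq x <- so_fv chi | x \notin r].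
    elim: r => [|y r IHr] /=; first by rewrite filter_predT.
    by rewrite IHr -filter_predI; apply: eq_filter => x; rewrite /= inE negb_or.
  rewrite /chi1 fvE -(filter_pred0 (so_fv chi)).
  by apply: eq_in_filter => x ->.
have fvE r : so_fvrel (foldr SOAllRel chi1 r) = [seq x <- so_fvrel chi1 | x \notin r].
  elim: r => [|y r IHr] /=; first by rewrite filter_predT.
  by rewrite IHr -filter_predI; apply: eq_filter => x; rewrite /= inE negb_or.
rewrite fvE -(filter_pred0 (so_fvrel chi1)).
by apply: eq_in_filter => x ->.
Qed.

Lemma so_theory_close (K : Type) chi :
  so_theory K (so_close chi) <->
  forall (e : nat -> K) (s : relassign K), so_sat e s chi.
Proof.
transitivity (forall (e : nat -> K) (s : relassign K), so_sat e s (so_close chi)).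
  by split=> [[]//|h]; split=> //; exact: so_close_sentence.
rewrite /so_close; set chi1 := so_close_elem chi.
transitivity (forall (e : nat -> K) (s : relassign K), so_sat e s chi1).
  elim: (so_fvrel chi1) => //= X r <-; split=> h e s; last by move=> A.
  have := h e s (s X); suff -> : dfwith s (s X) = s by [].
  apply: functional_extensionality_dep => Z.
  by have [<-|XZ] := eqVneq X Z; rewrite ?dfwith_in ?dfwith_out.
rewrite /chi1 /so_close_elem; elim: (so_fv chi) => //= x r <-; split=> h e s; last by move=> a.
by have := h e s (e x); rewrite eta_with_id.
Qed.

Lemma free_on_reindex (F : groupType) (I J : Type) (i0 : I -> F) (b : J -> I) :
  bijective b -> free_on i0 -> free_on (i0 \o b).
Proof.
move=> [c bK cK] [ex uniq]; split=> [H f|H g g' gM g'M gg'].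
  have [g gM gi] := ex H (f \o c); exists g => // j.
  by rewrite /= gi /= bK.
by apply: uniq => // i; rewrite -(cK i); exact: gg'.
Qed.

Lemma fo_theory_interpretable theta : fo_sentence theta ->
  exists theta' : so_formula, so_sentence theta' /\
    forall (K : Type) (F : groupType),
      infinite_set [set: K] -> free_of_rank F K ->
      (fo_theory (aut F) theta <-> so_theory K theta').
Proof.
(* The sentence asks for theta under every free operation of rank K on K. All of them give copies of
   F, so any one decides, and the operation transported from F ensures that the condition is not
   vacuous. *)
move=> thetaS; exists (so_close (SOAllGrp 0 (SOImp so_free (fo_to_so theta)))).
split; first exact: so_close_sentence.
move=> K F Kinf FK; rewrite so_theory_close.
have [I [i0 [_ _ _ [h0 [h0' h0K h0'K]]]]] := free_of_rank_data Kinf FK.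
(* [op_free_basis] indexes a basis by the carrier K itself, so B is reindexed along a bijection with
   K. *)
have [j Fj] : exists j : K -> F, free_on j.
  have [B FB] := FK; rewrite card_eq_le => /andP[/card_le_inj BK /card_le_inj KB].
  have {}BK := injects_trans BK (injects_setT K).2.
  have [f fI] := BK; have [g gI] := injects_trans (injects_setT K).1 KB.
  have [b bB] := inj_inj_bij gI fI.
  by exists (val \o b); exact: free_on_reindex bB (free_basis_on FB).
have main (v : nat -> K) s m b (e : nat -> aut F) : has3 s 0 m -> group_op m ->
    op_free_basis m b -> so_sat v s (fo_to_so theta) <-> fo_sat e theta.
  move=> sm mP mb; have [h [h' hK h'K] hM] := op_free_iso Fj h0K h0'K mP mb.
  by apply: (fo_to_soP hK h'K hM) => //; rewrite thetaS.
have sat_main (v : nat -> K) (s : relassign K) : so_sat v s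
    (SOAllGrp 0 (SOImp so_free (fo_to_so theta))) <->
  forall m, group_op m -> (exists b, op_free_basis m b) ->
     so_sat v (dfwith s (gr3 m : set ((3, 0).1.-tuple K))) (fo_to_so theta).
  apply: sat_all_grp => m mP; apply: sat_imp => //.
  exact: so_sat_free (has3_in s 0 m).
split=> [[_ ht] v s|ht].
  apply/sat_main => m mP [b mb].
  by apply/(main v _ m b (fun=> 1) (has3_in s 0 m) mP mb).
split=> // e; pose v (n : nat) := h0' 1.
pose s : relassign K := fun _ => set0.
have mP := op_transport_group h0K h0'K; have mb := op_transport_free Fj h0K h0'K.
apply/(main v _ _ _ e (has3_in s 0 _) mP mb).
by apply: (sat_main v s).1 => //; exists (h0' \o j).
Qed.

Theorem theorem7p1 :
  (forall chi : so_formula, so_sentence chi ->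
     exists chi' : fo_formula, fo_sentence chi' /\
       forall (K : Type) (F : groupType),
         infinite_set [set: K] -> free_of_rank F K ->
         (so_theory K chi <-> fo_theory (aut F) chi'))
  /\
  (forall theta : fo_formula, fo_sentence theta ->
     exists theta' : so_formula, so_sentence theta' /\
       forall (K : Type) (F : groupType),
         infinite_set [set: K] -> free_of_rank F K ->
         (fo_theory (aut F) theta <-> so_theory K theta')).
Proof.
split; [exact: so_theory_interpretable|exact: fo_theory_interpretable].
Qed.
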